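(* Let $\mathcal W$ and $\bar{\mathcal W}$ be two stellar sequences, and write $\mathcal O(\mathcal W)=\{|\Delta_0|\supseteq|\Delta_1|\supseteq\cdots\}$ and $\mathcal O(\bar{\mathcal W})=\{|\bar\Delta_0|\supseteq|\bar\Delta_1|\supseteq\cdots\}$ for their (canonical) orbits. Then the following conditions are equivalent: (i) $\mathcal G(\mathcal W)\cong\mathcal G(\bar{\mathcal W})$ (as unital $\ell$-groups). (ii) For some integer $i\ge 0$ there is a $\mathbb Z$-homeomorphism $\eta$ of $|\Delta_i|$ (onto a rational polyhedron in the Euclidean space containing $\mathcal O(\bar{\mathcal W})$) such that $\{\eta(|\Delta_i|),\eta(|\Delta_{i+1}|),\dots\}\uparrow\mathcal O(\bar{\mathcal W})$.
   Context: Unital $\ell$-groups. A unital $\ell$-group $(G,u)$ is an abelian group $G$ with a lattice structure such that $x+(y\vee z)=(x+y)\vee(x+z)$ for all $x,y,z$, together with a distinguished order-unit $u$, i.e. for every $g\in G$ there is an integer $k\ge 0$ with $g\le ku$. Unital $\ell$-homomorphisms are group homomorphisms preserving $\vee,\wedge$ and the order-unit; $\cong$ means there is a bijective one. An $\ell$-ideal is the kernel of a unital $\ell$-homomorphism. $\mathcal M([0,1]^n)$ is the unital $\ell$-group (pointwise operations, order-unit the constant $1$) of continuous piecewise linear functions $f\colon[0,1]^n\to\mathbb R$ with finitely many pieces, each piece affine with integer coefficients. For $f\in\mathcal M([0,1]^n)$ let $\mathcal Z(f)=f^{-1}(0)$. Polyhedra. A rational polyhedron in $\mathbb R^n$ is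 a finite union of convex hulls of finite sets of rational points. For rational polyhedra $P\subseteq\mathbb R^m$, $Q\subseteq\mathbb R^n$, a $\mathbb Z$-homeomorphism of $P$ onto $Q$ is a piecewise linear homeomorphism $\eta$ of $P$ onto $Q$ (finitely many affine pieces) such that all linear pieces of $\eta$ and $\eta^{-1}$ have integer coefficients. Confluence. A nonempty family $\mathcal P$ of subsets of a set $E$ is filtering if for all $X,Y\in\mathcal P$ there is $Z\in\mathcal P$ with $Z\subseteq X\cap Y$. For filtering families, $\mathcal P$ minorizes $\mathcal Q$ if for every $A\in\mathcal Q$ there is $B\in\mathcal P$ with $B\subseteq A$; $\mathcal P\uparrow\mathcal Q$ ($\mathcal P$ is confluent with $\mathcal Q$) means each minorizes the other. Regular complexes. For a rational point $y\in\mathbb R^n$, $\mathrm{den}(y)$ is the least common denominator of its coordinates and $\tilde y=\mathrm{den}(y)(y,1)\in\mathbb Z^{n+1}$. A simplex $\mathrm{conv}(v_0,\dots,v_k)\subseteq\mathbb R^n$ with rational vertices is regular if $\{\tilde v_0,\dots,\tilde v_k\}$ is part of a basis of the free abelian group $\mathbb Z^{n+1}$. A regular complex $\Delta$ is a finite (geometric) simplicial complex all of whose simplexes are rational and regular; its support $|\Delta|$ is the union of its simplexes. The Farey mediant of a regular $1$-simplex $\mathrm{conv}(v_0,v_1)$ is the rational point $v$ of it with $\tilde v=\tilde v_0+\tilde v_1$. The blow-up $\Delta_{(p)}$ of $\Delta$ at $p\in|\Delta|$ is obtained by replacing every $T\in\Delta$ containing $p$ by all simplexes $\mathrm{conv}(F\cup\{p\})$,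 with $F$ a face of $T$ not containing $p$. Weighted complexes and stellar sequences. A weighted abstract simplicial complex is a triple $W=(\mathcal V,\Sigma,\omega)$ where $\mathcal V$ is a finite nonempty set (of vertices), $\Sigma$ is a collection of subsets of $\mathcal V$ with union $\mathcal V$ and closed under taking subsets, and $\omega\colon\mathcal V\to\{1,2,3,\dots\}$. For a two-element set $\{v,w\}\in\Sigma$ and $a\notin\mathcal V$, the binary subdivision $(\{v,w\},a)W$ is obtained by adding $a$ to the vertex set, replacing every set $\{v,w,u_1,\dots,u_t\}\in\Sigma$ by the two sets $\{v,a,u_1,\dots,u_t\}$, $\{a,w,u_1,\dots,u_t\}$ and their faces, and extending the weight by $\omega(a)=\omega(v)+\omega(w)$. A sequence $\mathcal W=(W_0,W_1,\dots)$ of weighted abstract simplicial complexes is stellar if each $W_{j+1}$ is obtained from $W_j$ either by deleting a maximal set of $W_j$ (if this set is a singleton $\{v\}$, the vertex $v$ is removed too), or by a binary subdivision, or else $W_{j+1}=W_j$. Construction of $\mathcal G(\mathcal W)$. A $\nabla$-realization of $W=(\mathcal V,\Sigma,\omega)$, for $\nabla$ a regular complex, is a bijection $\iota$ from $\mathcal V$ onto the set of vertices of $\nabla$ such that $\mathrm{den}(\iota(v))=\omega(v)$ for all $v$, and $\{w_1,\dots,w_k\}\in\Sigma$ iff $\mathrm{conv}(\iota(w_1),\dots,\iota(w_k))\in\nabla$. Given a stellar sequence $\mathcal W$ and a $\Delta_0$-realization $\iota_0$ of $W_0$ with $|\Delta_0|\subseteq[0,1]^n$, define inductively $\Delta_j$-realizations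 $\iota_j$ of $W_j$: if $W_{j+1}$ is obtained by deleting the maximal set $M$, then $\Delta_{j+1}$ is $\Delta_j$ with the simplex $\mathrm{conv}(\iota_j(M))$ deleted and $\iota_{j+1}$ is the restriction of $\iota_j$; if $W_{j+1}=(\{a,b\},c)W_j$, then $\Delta_{j+1}=(\Delta_j)_{(e)}$ with $e$ the Farey mediant of $\mathrm{conv}(\iota_j(a),\iota_j(b))$, and $\iota_{j+1}=\iota_j\cup\{(c,e)\}$; if $W_{j+1}=W_j$ then $\Delta_{j+1}=\Delta_j$, $\iota_{j+1}=\iota_j$. The $\Delta_0$-orbit is $\mathcal O(\mathcal W,\Delta_0)=\{|\Delta_0|\supseteq|\Delta_1|\supseteq\cdots\}$; $\mathcal I(\mathcal W,\Delta_0)=\{f\in\mathcal M([0,1]^n)\mid \mathcal Z(f)\supseteq|\Delta_j|\text{ for some }j\}$, an $\ell$-ideal; and $\mathcal G(\mathcal W,\Delta_0)=\mathcal M([0,1]^n)/\mathcal I(\mathcal W,\Delta_0)$. The canonical realization of $W_0$ with vertices $v_1,\dots,v_n$ sends $v_i$ to $e_i/\omega(v_i)$ ($e_i$ the standard basis vectors of $\mathbb R^n$), and its regular complex $\Delta_{W_0}$ consists of the simplexes spanned by the images of the sets in $\Sigma$. $\mathcal O(\mathcal W),\mathcal I(\mathcal W),\mathcal G(\mathcal W)$ denote $\mathcal O(\mathcal W,\Delta_{W_0}),\mathcal I(\mathcal W,\Delta_{W_0}),\mathcal G(\mathcal W,\Delta_{W_0})$. *)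

(* Defs.v *)
From HB Require Import structures.
From mathcomp Require Import all_boot all_order all_algebra finmap.
From mathcomp Require Import generic_quotient ring_quotient.
From mathcomp Require Import all_classical all_reals all_analysis.

Set Implicit Arguments.
Unset Strict Implicit.
Unset Printing Implicit Defensive.

Import Order.TTheory GRing.Theory Num.Theory numFieldNormedType.Exports.

Local Open Scope classical_set_scope.
Local Open Scope ring_scope.

(* The lattice operations are fresh fields: Hierarchy-Builder refuses a join of
   GRing.Zmodule and Order.Lattice below the (totally ordered) Num.RealDomain.
   The order is recovered from the join in lle. *)
HB.mixin Record isLGroup (G : Type) of GRing.Zmodule G := {
  ljoin : G -> G -> G;
  lmeet : G -> G -> G;
  ljoinC : commutative ljoin;
  lmeetC : commutative lmeet;
  ljoinA : associative ljoin;
  lmeetA : associative lmeet;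
  ljoinK : forall x y : G, lmeet x (ljoin x y) = x;
  lmeetK : forall x y : G, ljoin x (lmeet x y) = x;
  addr_ljoin : forall x y z : G, x + ljoin y z = ljoin (x + y) (x + z)
}.

#[short(type="lgroupType")]
HB.structure Definition LGroup := {G of GRing.Zmodule G & isLGroup G}.

Definition lle (G : lgroupType) (x y : G) : Prop := ljoin x y = y.

HB.mixin Record hasOrderUnit (G : Type) of LGroup G := {
  order_unit : G;
  order_unitP : forall g : G, exists k : nat, lle g (order_unit *+ k)
}.

#[short(type="ulgroupType")]
HB.structure Definition ULGroup := {G of LGroup G & hasOrderUnit G}.

Record ulhom (G H : ulgroupType) (f : G -> H) : Prop := ULHom {
  ulhomD : {morph f : x y / x + y};
  ulhom_join : {morph f : x y / ljoin x y};
  ulhom_meet : {morph f : x y / lmeet x y};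
  ulhom_unit : f order_unit = order_unit
}.

Definition ul_isomorphic (G H : ulgroupType) : Prop :=
  exists f : G -> H, ulhom f /\ bijective f.

(* Kernels of l-homomorphisms are the same thing as convex l-subgroups, and the
   quotient below is built from the latter. *)
HB.mixin Record isConvexLSubset (G : lgroupType) (S : {pred G}) := {
  lideal_join : {in S &, forall x y, ljoin x y \in S};
  lideal_convex : forall x y z : G,
    x \in S -> z \in S -> lle x y -> lle y z -> y \in S
}.

#[short(type="lideal")]
HB.structure Definition LIdeal (G : lgroupType) :=
  {S of GRing.ZmodClosed G S & isConvexLSubset G S}.

Section LGroupTheory.
Variable G : lgroupType.
Implicit Types x y z : G.

Lemma ljoinxx x : ljoin x x = x.
Proof. by rewrite -{2}(ljoinK x x) lmeetK. Qed.

Lemma lle_joinl x y : lle x (ljoin x y).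
Proof. by rewrite /lle ljoinA ljoinxx. Qed.

Lemma lle_joinr x y : lle y (ljoin x y).
Proof. by rewrite ljoinC; apply: lle_joinl. Qed.

Lemma lle_trans y x z : lle x y -> lle y z -> lle x z.
Proof. by rewrite /lle => xy <-; rewrite ljoinA xy. Qed.

Lemma lle_join x y z : lle x z -> lle y z -> lle (ljoin x y) z.
Proof. by rewrite /lle => xz yz; rewrite -ljoinA yz. Qed.

Lemma lle_add2l x y z : lle x y -> lle (z + x) (z + y).
Proof. by rewrite /lle => xy; rewrite -addr_ljoin xy. Qed.

Lemma lle_add2r x y z : lle x y -> lle (x + z) (y + z).
Proof. by rewrite ![_ + z]addrC; apply: lle_add2l. Qed.

Lemma lleP_meet x y : lle x y <-> lmeet x y = x.
Proof.
split=> [<-|<-]; first exact: ljoinK.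
by rewrite /lle ljoinC lmeetC lmeetK.
Qed.

Lemma lle_meetl x y : lle (lmeet x y) x.
Proof. by rewrite /lle ljoinC lmeetK. Qed.

Lemma lle_meetr x y : lle (lmeet x y) y.
Proof. by rewrite lmeetC; apply: lle_meetl. Qed.

Lemma lle_meet x y z : lle z x -> lle z y -> lle z (lmeet x y).
Proof.
move=> /lleP_meet zx /lleP_meet zy; apply/lleP_meet.
by rewrite lmeetA zx.
Qed.

Variable S : lideal G.

Lemma lideal_bound x x' : x - x' \in S ->
  exists2 d, d \in S & [/\ lle 0 d, lle (x - x') d & lle (x' - x) d].
Proof.
move=> xS; have x'S : x' - x \in S by rewrite -opprB rpredN.
pose p := ljoin (x - x') 0; pose q := ljoin (x' - x) 0.
have pS : p \in S by apply: lideal_join; rewrite ?rpred0.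
have qS : q \in S by apply: lideal_join; rewrite ?rpred0.
have p0 : lle 0 p by exact: lle_joinr.
have q0 : lle 0 q by exact: lle_joinr.
have pd : lle p (p + q) by rewrite -{1}[p]addr0; apply: lle_add2l.
have qd : lle q (p + q) by rewrite -{1}[q]add0r; apply: lle_add2r.
exists (p + q); first exact: rpredD.
split; [exact: lle_trans pd | apply: lle_trans pd | apply: lle_trans qd];
  exact: lle_joinl.
Qed.

Lemma lideal_squeeze x y d : d \in S ->
  lle x (d + y) -> lle y (d + x) -> x - y \in S.
Proof.
move=> dS xy yx; apply: (@lideal_convex _ S (- d) _ d) => //.
- by rewrite rpredN.
- by move: (lle_add2r (- d - y) yx); rewrite addrC subrK addrACA subrr add0r.
- by move: (lle_add2r (- y) xy); rewrite addrK.
Qed.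

End LGroupTheory.

Section LQuotient.
Local Open Scope quotient_scope.
Variables (G : lgroupType) (S : lideal G).

Definition lquot : Type := Quotient.quot S.
HB.instance Definition _ := GRing.Zmodule.on lquot.

Definition lpi (x : G) : lquot := \pi_(Quotient.quot S) x.

Lemma lpiP x y : lpi x = lpi y <-> x - y \in S.
Proof.
rewrite /lpi; split=> [/eqP|] xy; first by rewrite Quotient.idealrBE.
by apply/eqP; rewrite -Quotient.idealrBE.
Qed.

Lemma lpiK (a : lquot) : lpi (repr a) = a.
Proof. exact: reprK. Qed.

Lemma lpiD x y : lpi (x + y) = lpi x + lpi y.
Proof. exact: Quotient.pi_add. Qed.

Lemma lpiMn x k : lpi (x *+ k) = lpi x *+ k.
Proof.
elim: k => [|k IH]; last by rewrite !mulrS lpiD IH.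
by apply: (@addrI _ (lpi 0)); rewrite -lpiD !addr0.
Qed.

Definition qjoin (a b : lquot) : lquot := lpi (ljoin (repr a) (repr b)).
Definition qmeet (a b : lquot) : lquot := lpi (lmeet (repr a) (repr b)).

Lemma lpi_bound x x' : lpi x = lpi x' ->
  exists2 d, d \in S & [/\ lle 0 d, lle x (d + x') & lle x' (d + x)].
Proof.
move=> /lpiP /lideal_bound[d dS [d0 xd x'd]]; exists d => //; split=> //.
- by move: (lle_add2r x' xd); rewrite subrK.
- by move: (lle_add2r x x'd); rewrite subrK.
Qed.

Lemma lpi_join_congr x x' y : lpi x = lpi x' ->
  lpi (ljoin x y) = lpi (ljoin x' y).
Proof.
move=> /lpi_bound[d dS [d0 xd x'd]]; apply/lpiP.
have yd : lle y (d + y) by rewrite -{1}[y]add0r; apply: lle_add2r.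
by apply: (lideal_squeeze dS); apply: lle_join; rewrite addr_ljoin;
  [apply: lle_trans xd _ | apply: lle_trans yd _ |
   apply: lle_trans x'd _ | apply: lle_trans yd _];
  exact: lle_joinl || exact: lle_joinr.
Qed.

Lemma lpi_meet_congr x x' y : lpi x = lpi x' ->
  lpi (lmeet x y) = lpi (lmeet x' y).
Proof.
move=> /lpi_bound[d dS [d0 xd x'd]]; apply/lpiP.
have yd : lle y (d + y) by rewrite -{1}[y]add0r; apply: lle_add2r.
have key u u' : lle u (d + u') -> lle (lmeet u y) (d + lmeet u' y).
  move=> uu'; rewrite -[lmeet u y](subrK d) addrC; apply: lle_add2l.
  apply: lle_meet.
  - have := lle_add2r (- d) (lle_trans (lle_meetl u y) uu').
    by rewrite [d + u']addrC addrK.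
  - have := lle_add2r (- d) (lle_trans (lle_meetr u y) yd).
    by rewrite [d + y]addrC addrK.
by apply: (lideal_squeeze dS); apply: key.
Qed.

Lemma lpi_join x y : lpi (ljoin x y) = qjoin (lpi x) (lpi y).
Proof.
rewrite /qjoin (lpi_join_congr _ (lpiK _)) ljoinC.
by rewrite (lpi_join_congr _ (esym (lpiK (lpi y)))) ljoinC.
Qed.

Lemma lpi_meet x y : lpi (lmeet x y) = qmeet (lpi x) (lpi y).
Proof.
rewrite /qmeet (lpi_meet_congr _ (lpiK _)) lmeetC.
by rewrite (lpi_meet_congr _ (esym (lpiK (lpi y)))) lmeetC.
Qed.

Fact qjoinC : commutative qjoin.
Proof. by move=> a b; rewrite /qjoin ljoinC. Qed.

Fact qmeetC : commutative qmeet.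
Proof. by move=> a b; rewrite /qmeet lmeetC. Qed.

Fact qjoinA : associative qjoin.
Proof.
by move=> a b c; rewrite -[a]lpiK -[b]lpiK -[c]lpiK -!lpi_join ljoinA.
Qed.

Fact qmeetA : associative qmeet.
Proof.
by move=> a b c; rewrite -[a]lpiK -[b]lpiK -[c]lpiK -!lpi_meet lmeetA.
Qed.

Fact qjoinK a b : qmeet a (qjoin a b) = a.
Proof. by rewrite -[a]lpiK -[b]lpiK -lpi_join -lpi_meet ljoinK. Qed.

Fact qmeetK a b : qjoin a (qmeet a b) = a.
Proof. by rewrite -[a]lpiK -[b]lpiK -lpi_meet -lpi_join lmeetK. Qed.

Fact addr_qjoin a b c : a + qjoin b c = qjoin (a + b) (a + c).
Proof.
rewrite -[a]lpiK -[b]lpiK -[c]lpiK -lpi_join -!lpiD addr_ljoin.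
exact: lpi_join.
Qed.

HB.instance Definition _ := isLGroup.Build lquot
  qjoinC qmeetC qjoinA qmeetA qjoinK qmeetK addr_qjoin.

End LQuotient.

Section ULQuotient.
Variables (G : ulgroupType) (S : lideal G).

Fact lquot_unitP (a : lquot S) :
  exists k : nat, lle a (lpi S order_unit *+ k).
Proof.
have [k ak] := order_unitP (repr a); exists k.
by rewrite /lle -lpiMn -[a]lpiK -[ljoin _ _]lpi_join ak.
Qed.

HB.instance Definition _ := hasOrderUnit.Build (lquot S) lquot_unitP.

End ULQuotient.

Section McNaughton.
Variable R : realType.

(* Row vectors are points, so that x |-> x *m A + b is the general affine map;
   A and b are integral. *)
Definition affineZ n m (A : 'M[int]_(n, m)) (b : 'rV[int]_m) (x : 'rV[R]_n) :
    'rV[R]_m :=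
  x *m map_mx intr A + map_mx intr b.

Definition cube n : set 'rV[R]_n := [set x | forall i, 0 <= x 0 i <= 1].
Arguments cube : clear implicits.

(* Continuous functions on [0,1]^n (with the subspace topology) that agree at
   each point with one out of finitely many integral affine functions. *)
Definition mcnaughton n (f : cube n -> R) : Prop :=
  continuous f /\
  exists s : seq ('M[int]_(n, 1) * 'rV[int]_1), forall x : cube n,
    exists2 p, p \in s & f x = affineZ p.1 p.2 (\val x) 0 0.

Definition mcnaughton_pred n : {pred cube n -> R} :=
  fun f => `[< mcnaughton f >].
Arguments mcnaughton_pred : clear implicits.

Section Closure.
Variable n : nat.
Implicit Types f g : cube n -> R.

Lemma affineZB m (A A' : 'M[int]_(n, m)) b b' (x : 'rV[R]_n) :
  affineZ (A - A') (b - b') x = affineZ A b x - affineZ A' b' x.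
Proof. by rewrite /affineZ !map_mxB mulmxBr opprD addrACA. Qed.

Lemma affineZ0 m (b : 'rV[int]_m) (x : 'rV[R]_n) :
  affineZ 0 b x = map_mx intr b.
Proof. by rewrite /affineZ map_mx0 mulmx0 add0r. Qed.

Lemma mcnaughton_cst (k : int) : mcnaughton ((fun=> k%:~R) : cube n -> R).
Proof.
split; first by exact: cst_continuous.
exists [:: (0, const_mx k)] => x; exists (0, const_mx k); rewrite ?mem_head //=.
by rewrite affineZ0 !mxE.
Qed.

Lemma mcnaughtonB f g : mcnaughton f -> mcnaughton g -> mcnaughton (f - g).
Proof.
move=> [cf [s sf]] [cg [t tg]]; split.
  by move=> x; apply: (@continuousB _ _ _ f g); [exact: cf | exact: cg].
exists [seq (p.1 - q.1, p.2 - q.2) | p <- s, q <- t] => x.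
have [p ps fx] := sf x; have [q qt gx] := tg x.
exists (p.1 - q.1, p.2 - q.2); first by apply/allpairsP; exists (p, q).
have -> : (f - g) x = f x - g x by [].
by rewrite fx gx /= affineZB [RHS]mxE; congr (_ + _); rewrite [RHS]mxE.
Qed.

Lemma mcnaughton_join f g : mcnaughton f -> mcnaughton g ->
  mcnaughton (f \max g).
Proof.
move=> [cf [s sf]] [cg [t tg]]; split.
  by move=> x; apply: (@continuous_max _ _ f g); [exact: cf | exact: cg].
exists (s ++ t) => x.
have [p ps fx] := sf x; have [q qt gx] := tg x.
rewrite /= maxEle; case: ifP => _.
  by exists q; rewrite // mem_cat qt orbT.
by exists p; rewrite // mem_cat ps.
Qed.

Lemma mcnaughton_meet f g : mcnaughton f -> mcnaughton g ->
  mcnaughton (f \min g).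
Proof.
move=> [cf [s sf]] [cg [t tg]]; split.
  by move=> x; apply: (@continuous_min _ _ f g); [exact: cf | exact: cg].
exists (s ++ t) => x.
have [p ps fx] := sf x; have [q qt gx] := tg x.
rewrite /= minEle; case: ifP => _.
  by exists p; rewrite // mem_cat ps.
by exists q; rewrite // mem_cat qt orbT.
Qed.

Fact mcnaughton_zmod_closed : zmod_closed (mcnaughton_pred n).
Proof.
split; first by apply/asboolP; exact: (mcnaughton_cst 0).
by move=> f g /asboolP mf /asboolP mg; apply/asboolP; exact: mcnaughtonB.
Qed.
HB.instance Definition _ :=
  GRing.isZmodClosed.Build (cube n -> R) (mcnaughton_pred n)
    mcnaughton_zmod_closed.

Record mcfun := McFun {
  mcval :> cube n -> R;
  _ : mcval \in mcnaughton_pred n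
}.

HB.instance Definition _ := [isSub for mcval].
HB.instance Definition _ := [Choice of mcfun by <:].
HB.instance Definition _ := [SubChoice_isSubZmodule of mcfun by <:].

Lemma mcfunP (f : mcfun) : mcnaughton f.
Proof. by case: f => f /= /asboolP. Qed.

Lemma mcvalD (f g : mcfun) x : (f + g) x = f x + g x.
Proof. by []. Qed.

Definition mcjoin (f g : mcfun) : mcfun :=
  McFun (asboolT (mcnaughton_join (mcfunP f) (mcfunP g))).
Definition mcmeet (f g : mcfun) : mcfun :=
  McFun (asboolT (mcnaughton_meet (mcfunP f) (mcfunP g))).

Lemma mcfun_eq (f g : mcfun) : (forall x, f x = g x) -> f = g.
Proof. by move=> fg; apply: val_inj; apply/funext. Qed.

Fact mcjoinC : commutative mcjoin.
Proof. by move=> f g; apply: mcfun_eq => x /=; exact: maxC. Qed.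

Fact mcmeetC : commutative mcmeet.
Proof. by move=> f g; apply: mcfun_eq => x /=; exact: minC. Qed.

Fact mcjoinA : associative mcjoin.
Proof. by move=> f g h; apply: mcfun_eq => x /=; exact: maxA. Qed.

Fact mcmeetA : associative mcmeet.
Proof. by move=> f g h; apply: mcfun_eq => x /=; exact: minA. Qed.

Fact mcjoinK (f g : mcfun) : mcmeet f (mcjoin f g) = f.
Proof.
apply: mcfun_eq => x /=; have [fg|fg] := leP (f x) (g x).
  by apply/min_idPl.
by rewrite minxx.
Qed.

Fact mcmeetK (f g : mcfun) : mcjoin f (mcmeet f g) = f.
Proof.
apply: mcfun_eq => x /=; have [fg|fg] := leP (f x) (g x).
  by rewrite maxxx.
by apply/max_idPl/ltW.
Qed.

Fact addr_mcjoin (f g h : mcfun) : f + mcjoin g h = mcjoin (f + g) (f + h).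
Proof.
apply: mcfun_eq => x; rewrite mcvalD.
exact: (addr_maxr (f x) (g x) (h x)).
Qed.

HB.instance Definition _ := isLGroup.Build mcfun
  mcjoinC mcmeetC mcjoinA mcmeetA mcjoinK mcmeetK addr_mcjoin.

Lemma lle_mcfun (f g : mcfun) : lle f g <-> forall x, f x <= g x.
Proof.
split=> [fg x|fg].
  apply/max_idPr; move: (congr1 (fun h : mcfun => h x) fg); exact.
by apply: mcfun_eq => x; apply/max_idPr.
Qed.

Definition mcone : mcfun := McFun (asboolT (mcnaughton_cst 1)).

Lemma mcvalMn (f : mcfun) k x : (f *+ k) x = f x *+ k.
Proof. by elim: k => [|k IH]; rewrite ?mulr0n // !mulrS mcvalD IH. Qed.

Fact mcone_unit (f : mcfun) : exists k : nat, lle f (mcone *+ k).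
Proof.
have [_ [s sf]] := mcfunP f.
pose B (p : 'M[int]_(n, 1) * 'rV[int]_1) : nat :=
  (\sum_i `|p.1 i ord0| + `|p.2 ord0 ord0|)%N.
exists (\sum_(p <- s) B p)%N; apply/lle_mcfun => x; rewrite mcvalMn /= mulr1z.
have [p ps ->] := sf x.
apply: (@le_trans _ _ ((B p)%:R)); last first.
  by rewrite ler_nat (big_rem p) //= leq_addr.
rewrite natrD natr_sum !mxE; apply: lerD; last first.
  by rewrite pmulrn abszE ler_int ler_norm.
apply: ler_sum => i _; rewrite mxE pmulrn abszE.
have /andP[x0 x1] : 0 <= (\val x : 'rV[R]_n) 0 i <= 1.
  by have /set_mem := valP x; apply.
apply: le_trans (ler_norm _) _; rewrite normrM (ger0_norm x0) -intr_norm.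
by rewrite ler_piMl.
Qed.

HB.instance Definition _ := hasOrderUnit.Build mcfun mcone_unit.

Definition zeroset (f : mcfun) : set 'rV[R]_n :=
  [set \val x | x in [set x : cube n | f x = 0]].

End Closure.
End McNaughton.
Arguments cube : clear implicits.
Arguments mcfun : clear implicits.

Section Polyhedra.
Variable R : realType.

Definition ratpt n (q : 'rV[rat]_n) : 'rV[R]_n := map_mx ratr q.

Definition den n (q : 'rV[rat]_n) : nat :=
  \big[lcmn/1%N]_(i < n) `|denq (q ord0 i)|%N.

(* The vector den(q)(q, 1); numq only casts its entries, which are integers. *)
Definition homog n (q : 'rV[rat]_n) : 'rV[int]_(n + 1) :=
  map_mx numq ((den q)%:R *: row_mx q 1).

Definition conv n (S : {fset 'rV[rat]_n}) : set 'rV[R]_n :=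
  [set x | exists c : 'rV[rat]_n -> R,
    [/\ forall q, q \in S -> 0 <= c q,
        \sum_(q <- S) c q = 1 &
        x = \sum_(q <- S) c q *: ratpt q]].

Definition rational_polyhedron n (P : set 'rV[R]_n) : Prop :=
  exists s : seq {fset 'rV[rat]_n}, P = \bigcup_(S in [set` s]) conv S.

(* Continuous maps on P that agree at each point with one out of finitely many
   integral affine maps. *)
Definition Zmap n m (P : set 'rV[R]_n) (f : 'rV[R]_n -> 'rV[R]_m) : Prop :=
  {within P, continuous f} /\
  exists s : seq ('M[int]_(n, m) * 'rV[int]_m), forall x, P x ->
    exists2 p, p \in s & f x = affineZ p.1 p.2 x.

Definition Zhomeo n m (P : set 'rV[R]_n) (Q : set 'rV[R]_m)
    (f : 'rV[R]_n -> 'rV[R]_m) : Prop :=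
  [/\ Zmap P f, set_bij P Q f &
      exists g : 'rV[R]_m -> 'rV[R]_n,
        Zmap Q g /\ forall x, P x -> g (f x) = x].

End Polyhedra.
Arguments ratpt R {n} q.
Arguments conv R {n} S.

Section Confluence.
Variable E : Type.
Implicit Types P Q : set (set E).

Definition minorizes P Q : Prop :=
  forall A, Q A -> exists2 B, P B & B `<=` A.

Definition confluent P Q : Prop := minorizes P Q /\ minorizes Q P.

End Confluence.

Section Weighted.
Variable K : choiceType.

Record wcomplex := WComplex {
  faces : set {fset K};
  weight : {fmap K -> nat}
}.

Definition vertices (W : wcomplex) : {fset K} := domf (weight W).

Definition wt (W : wcomplex) (x : K) : nat := odflt 0%N (weight W).[? x]%fmap.

Record is_wcomplex (W : wcomplex) : Prop := IsWComplex {
  wcomplex_nonempty : vertices W != fset0;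
  wcomplex_faces : forall F, faces W F -> (F `<=` vertices W)%fset;
  wcomplex_cover : forall x, x \in vertices W -> exists2 F, faces W F & x \in F;
  wcomplex_down : forall F F', faces W F -> (F' `<=` F)%fset -> faces W F';
  wcomplex_pos : forall x, x \in vertices W -> (0 < wt W x)%N
}.

Definition maximal_face (W : wcomplex) (M : {fset K}) : Prop :=
  faces W M /\ forall F, faces W F -> (M `<=` F)%fset -> F = M.

Definition delete (M : {fset K}) (W : wcomplex) : wcomplex :=
  WComplex (faces W `\ M)
    (if #|` M| == 1%N then (weight W).[\ M]%fmap else weight W).

Definition subdivide (v w a : K) (W : wcomplex) : wcomplex :=
  WComplex
    ([set F | faces W F /\ ~ (v \in F /\ w \in F)] `|`
     [set F | exists T, [/\ faces W T, v \in T, w \in T &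
        (F `<=` a |` (T `\ w))%fset \/ (F `<=` a |` (T `\ v))%fset]])
    (weight W).[a <- (wt W v + wt W w)%N]%fmap.

Inductive move := Keep | Delete of {fset K} | Subdivide of K & K & K.

HB.instance Definition _ := gen_eqMixin move.
HB.instance Definition _ := gen_choiceMixin move.

Definition obtained (mv : move) (W W' : wcomplex) : Prop :=
  match mv with
  | Keep => W' = W
  | Delete M => maximal_face W M /\ W' = delete M W
  | Subdivide v w a =>
      [/\ v != w, faces W [fset v; w]%fset, a \notin vertices W &
          W' = subdivide v w a W]
  end.

Definition stellar (W : nat -> wcomplex) : Prop :=
  forall j, is_wcomplex (W j) /\ exists mv, obtained mv (W j) (W j.+1).

(* Up to exchanging v and w in a subdivision, the move leading from W to W' is
   unique. *)
Definition move_of (W W' : wcomplex) : move :=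
  xget Keep [set mv | obtained mv W W'].

Definition enumerates n (v : n.-tuple K) (W : wcomplex) : Prop :=
  uniq v /\ v =i vertices W.

End Weighted.

Section Orbit.
Variables (R : realType) (K : choiceType) (n : nat).

(* A simplex is represented by the set of its vertices. *)
Definition complex := set {fset 'rV[rat]_n}.
Implicit Types (D : complex) (i : K -> 'rV[rat]_n) (v : n.-tuple K).

Definition cx_support D : set 'rV[R]_n := \bigcup_(T in D) conv R T.

Definition Farey_mediant (p q : 'rV[rat]_n) : 'rV[rat]_n :=
  xget 0 [set e | conv R [fset p; q]%fset (ratpt R e) /\
                  homog e = homog p + homog q].

(* The face F is allowed to be empty. *)
Definition blow_up (p : 'rV[rat]_n) D : complex :=
  [set T | D T /\ ~ conv R T (ratpt R p)] `|`
  [set S | exists T F, [/\ D T, conv R T (ratpt R p), (F `<=` T)%fset,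
                           ~ conv R F (ratpt R p) & S = (p |` F)%fset]].

(* A realization is given by the geometric complex and the map from the abstract
   vertices, whose values outside of the current vertex set are irrelevant. *)
Definition geo_step (mv : move K) (Di : complex * (K -> 'rV[rat]_n)) :
    complex * (K -> 'rV[rat]_n) :=
  let: (D, i) := Di in
  match mv with
  | Keep => (D, i)
  | Delete M => (D `\ [fset i x | x in M]%fset, i)
  | Subdivide a b c =>
      let e := Farey_mediant (i a) (i b) in
      (blow_up e D, fun x => if x == c then e else i x)
  end.

(* The k-th vertex in the list v is sent to the k-th standard basis vector
   divided by its weight. *)
Definition canonical_vertex (W : wcomplex K) v (x : K) : 'rV[rat]_n :=
  \row_k ((tnth v k == x)%:R / (wt W x)%:R).

Definition canonical_complex (W : wcomplex K) v : complex :=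
  [set [fset canonical_vertex W v x | x in F]%fset | F in faces W].

Variable W : nat -> wcomplex K.

Fixpoint realization v (j : nat) : complex * (K -> 'rV[rat]_n) :=
  if j is k.+1 then geo_step (move_of (W k) (W k.+1)) (realization v k)
  else (canonical_complex (W 0%N) v, canonical_vertex (W 0%N) v).

Definition stellar_orbit v (j : nat) : set 'rV[R]_n := cx_support (realization v j).1.

Definition orbit_family v : set (set 'rV[R]_n) := range (stellar_orbit v).

Definition orbit_ideal v : {pred mcfun R n} :=
  fun f => `[< exists j, stellar_orbit v j `<=` zeroset f >].

Lemma conv_vertex (S : {fset 'rV[rat]_n}) q : q \in S -> conv R S (ratpt R q).
Proof.
move=> qS; exists (fun q' => (q' == q)%:R); split=> [q' _||].
- by rewrite ler0n.
- rewrite (big_rem q) //= eqxx big_seq big1 ?addr0 // => q'.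
  by rewrite (mem_rem_uniq _ (fset_uniq S)) => /andP[/negPf ->].
- rewrite (big_rem q) //= eqxx scale1r big_seq big1 ?addr0 // => q'.
  by rewrite (mem_rem_uniq _ (fset_uniq S)) => /andP[/negPf ->]; rewrite scale0r.
Qed.

Lemma conv_conv (S T : {fset 'rV[rat]_n}) :
  (forall q, q \in S -> conv R T (ratpt R q)) -> conv R S `<=` conv R T.
Proof.
move=> ST x [c [c0 c1 ->]].
have /choice[d dP] : forall q : 'rV[rat]_n, exists d : 'rV[rat]_n -> R,
    q \in S -> [/\ forall t, t \in T -> 0 <= d t, \sum_(t <- T) d t = 1 &
                   ratpt R q = \sum_(t <- T) d t *: ratpt R t].
  move=> q; have [qS|_] := boolP (q \in S); last by exists (fun=> 0).
  by have [d ?] := ST q qS; exists d.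
exists (fun t => \sum_(q <- S) c q * d q t); split=> [t tT||].
- rewrite big_seq; apply: sumr_ge0 => q qS; apply: mulr_ge0; first exact: c0.
  by have [d0 _ _] := dP q qS; exact: d0.
- rewrite exchange_big /= -c1 [LHS]big_seq [RHS]big_seq.
  apply: eq_bigr => q qS; rewrite -mulr_sumr.
  by have [_ -> _] := dP q qS; rewrite mulr1.
- rewrite [RHS](eq_bigr (fun t => \sum_(q <- S) c q *: (d q t *: ratpt R t)));
    last first.
    by move=> t _; rewrite scaler_suml; apply: eq_bigr => q _; rewrite scalerA.
  rewrite exchange_big /= [LHS]big_seq [RHS]big_seq.
  apply: eq_bigr => q qS; rewrite -scaler_sumr.
  by have [_ _ <-] := dP q qS.
Qed.

Lemma cx_support_blow_up p D : cx_support (blow_up p D) `<=` cx_support D.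
Proof.
move=> x [S [[DS _]|[T [F [DT Tp FT _ ->]]]]] Sx; first by exists S.
exists T => //; move: x Sx; apply: conv_conv => q.
by rewrite !inE => /orP[/eqP -> //|qF]; apply/conv_vertex/(fsubsetP FT).
Qed.

Lemma orbitS v j : stellar_orbit v j.+1 `<=` stellar_orbit v j.
Proof.
rewrite /stellar_orbit /=; case: (realization v j) => D i.
case: (move_of _ _) => [|M|a b c] //=; last exact: cx_support_blow_up.
by move=> x [S [DS _] Sx]; exists S.
Qed.

Lemma orbit_le v j k : (j <= k)%N -> stellar_orbit v k `<=` stellar_orbit v j.
Proof.
move=> /subnK <-; elim: (k - j)%N => [//|l IH].
by rewrite addSn => x /orbitS; exact: IH.
Qed.

Lemma orbit_cube v j : stellar_orbit v j `<=` cube R n.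
Proof.
apply: subset_trans (orbit_le (leq0n j)) _.
move=> x [_ [F _ <-] [c [c0 c1 ->]]] k; rewrite summxE.
have H q : q \in [fset canonical_vertex (W 0%N) v x | x in F]%fset ->
    0 <= ratpt R q 0 k <= 1.
  move=> /imfsetP[y _ ->]; rewrite !mxE ler0q -[X in _ && (_ <= X)](rmorph1 (@ratr R)).
  rewrite ler_rat.
  rewrite divr_ge0 ?ler0n //=; case: (wt _ _) => [|w].
    by rewrite invr0 mulr0 ler01.
  by rewrite ler_pdivrMr ?ltr0n // mul1r ler_nat; case: (_ == _).
rewrite -c1 [in X in _ && X]big_seq [in X in X && _]big_seq.
rewrite [X in _ && (_ <= X)]big_seq.
apply/andP; split.
  apply: sumr_ge0 => q qS; rewrite mxE mulr_ge0 ?c0 //.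
  by have /andP[] := H q qS.
apply: ler_sum => q qS; rewrite mxE ler_piMr ?c0 //.
by have /andP[] := H q qS.
Qed.

Lemma zerosetE (f : mcfun R n) (P : set 'rV[R]_n) : P `<=` cube R n ->
  P `<=` zeroset f <-> forall x : cube R n, P (\val x) -> f x = 0.
Proof.
move=> PC; split=> [Pf x /Pf[y fy /val_inj <-] //|Pf x Px].
by exists (exist _ x (mem_set (PC x Px))) => //; exact: Pf.
Qed.

Lemma orbit_idealP v (f : mcfun R n) : f \in orbit_ideal v <->
  exists j, forall x : cube R n, stellar_orbit v j (\val x) -> f x = 0.
Proof.
split=> [/asboolP[j]|[j jf]].
  by move/(zerosetE _ (@orbit_cube v j)); exists j.
by apply/asboolP; exists j; apply/(zerosetE _ (@orbit_cube v j)).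
Qed.

Fact orbit_ideal2 v (f g : mcfun R n) :
  f \in orbit_ideal v -> g \in orbit_ideal v ->
  exists j, forall x : cube R n, stellar_orbit v j (\val x) -> f x = 0 /\ g x = 0.
Proof.
move=> /orbit_idealP[j fj] /orbit_idealP[k gk]; exists (maxn j k) => x xP.
split; [apply: fj | apply: gk]; apply: orbit_le xP.
  exact: leq_maxl.
exact: leq_maxr.
Qed.

Fact orbit_ideal_zmod_closed v : zmod_closed (orbit_ideal v).
Proof.
split=> [|f g fI gI]; apply/orbit_idealP; first by exists 0%N.
have [j jfg] := orbit_ideal2 fI gI; exists j => x /jfg[fx gx].
by rewrite -[LHS]/(f x - g x) fx gx subrr.
Qed.

HB.instance Definition _ v :=
  GRing.isZmodClosed.Build (mcfun R n) (orbit_ideal v)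
    (orbit_ideal_zmod_closed v).

Fact orbit_ideal_join v :
  {in orbit_ideal v &, forall f g, ljoin f g \in orbit_ideal v}.
Proof.
move=> f g fI gI; apply/orbit_idealP.
have [j jfg] := orbit_ideal2 fI gI; exists j => x /jfg[fx gx].
by rewrite -[LHS]/(Num.max (f x) (g x)) fx gx maxxx.
Qed.

Fact orbit_ideal_convex v (f g h : mcfun R n) :
  f \in orbit_ideal v -> h \in orbit_ideal v -> lle f g -> lle g h ->
  g \in orbit_ideal v.
Proof.
move=> fI hI /lle_mcfun fg /lle_mcfun gh; apply/orbit_idealP.
have [j jfh] := orbit_ideal2 fI hI; exists j => x /jfh[fx hx].
by apply/eqP; rewrite eq_le; move: (fg x) (gh x); rewrite fx hx => -> ->.
Qed.

HB.instance Definition _ v :=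
  isConvexLSubset.Build (mcfun R n) (orbit_ideal v)
    (@orbit_ideal_join v) (@orbit_ideal_convex v).

Definition orbit_group v : ulgroupType := lquot (orbit_ideal v).

End Orbit.
Arguments cx_support R {n} D.
Arguments Farey_mediant R {n} p q.
Arguments blow_up R {n} p D.
Arguments realization R {K n} W v j.
Arguments stellar_orbit R {K n} W v j.
Arguments orbit_family R {K n} W v.
Arguments orbit_ideal R {K n} W v.
Arguments orbit_group R {K n} W v.

(* Main.v *)
(* For a rational polyhedron P, every continuous function on P with finitely many
   integral affine pieces coincides on P with a term in the coordinates, 1, the group
   operations and the lattice operations; and P is the zero set of such a term.
   Hence every element of G(W) is the value of a term at the classes of the
   coordinate functions, two terms have the same value iff they agree on some
   |Delta_j|, and an isomorphism and its inverse are two tuples of terms.  As maps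
   between Euclidean spaces these tuples are mutually inverse far enough along the
   orbits; applied to terms with zero sets |Delta_j|, the homomorphism property says
   that the images of the orbits are confluent.  Conversely a Z-homeomorphism and its
   inverse are given by terms, and substitution of terms induces the isomorphism. *)

From HB Require Import structures.
Require Import Defs.
From mathcomp Require Import all_boot all_order all_algebra finmap.
From mathcomp Require Import all_classical all_reals all_analysis.
From mathcomp Require Import lra.

Set Implicit Arguments.
Unset Strict Implicit.
Unset Printing Implicit Defensive.

Import Order.TTheory GRing.Theory Num.Theory numFieldNormedType.Exports.

Local Open Scope classical_set_scope.
Local Open Scope ring_scope.

(** * Cones generated by integral vectors *)

Section Cones.
Variables (R : realFieldType) (d : nat).
Implicit Types (z w : 'rV[int]_d) (zs : seq 'rV[int]_d) (a b : 'cV[int]_d).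
Implicit Types (y : 'rV[R]_d).

Definition ivec z : 'rV[R]_d := map_mx intr z.
Definition lin a y : R := (y *m map_mx intr a) 0 0.
Definition ilin a z : int := (z *m a) 0 0.

Lemma lin_ivec a z : lin a (ivec z) = (ilin a z)%:~R.
Proof. by rewrite /lin /ilin /ivec -map_mxM mxE. Qed.

Lemma lin0r a : lin a 0 = 0.
Proof. by rewrite /lin mul0mx mxE. Qed.

Lemma linDr a y1 y2 : lin a (y1 + y2) = lin a y1 + lin a y2.
Proof. by rewrite /lin mulmxDl mxE. Qed.

Lemma linZr a k y : lin a (k *: y) = k * lin a y.
Proof. by rewrite /lin -scalemxAl mxE. Qed.

Lemma linBr a y1 y2 : lin a (y1 - y2) = lin a y1 - lin a y2.
Proof. by rewrite -scaleN1r linDr linZr mulN1r. Qed.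

Lemma linDl a b y : lin (a + b) y = lin a y + lin b y.
Proof. by rewrite /lin map_mxD mulmxDr mxE. Qed.

Lemma linZl (k : int) a y : lin (k *: a) y = k%:~R * lin a y.
Proof. by rewrite /lin map_mxZ -scalemxAr mxE. Qed.

Lemma linNl a y : lin (- a) y = - lin a y.
Proof. by rewrite -scaleN1r linZl mulrN1z mulN1r. Qed.

Lemma linBl a b y : lin (a - b) y = lin a y - lin b y.
Proof. by rewrite linDl linNl. Qed.

Lemma ilinD a z w : ilin a (z + w) = ilin a z + ilin a w.
Proof. by rewrite /ilin mulmxDl mxE. Qed.

Lemma ilinZ a k z : ilin a (k *: z) = k * ilin a z.
Proof. by rewrite /ilin -scalemxAl mxE. Qed.

Lemma ivecZ k z : ivec (k *: z) = k%:~R *: ivec z.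
Proof. exact: map_mxZ. Qed.

Lemma ivecB z w : ivec (z - w) = ivec z - ivec w.
Proof. exact: map_mxB. Qed.

(** Unfolded one coefficient at a time, so that induction on the list of generators eliminates a
    single real variable. *)
Fixpoint cone zs : set 'rV[R]_d :=
  if zs is z :: zs' then
    [set y | exists2 t, 0 <= t & cone zs' (y - t *: ivec z)]
  else [set 0].

Lemma cone0 zs : cone zs 0.
Proof.
elim: zs => [//|z zs IH] /=; exists 0 => //.
by rewrite scale0r subr0.
Qed.

Lemma coneD zs y1 y2 : cone zs y1 -> cone zs y2 -> cone zs (y1 + y2).
Proof.
elim: zs y1 y2 => [|z zs IH] y1 y2 /=; first by move=> -> ->; rewrite addr0.
move=> [t t0 y1t] [u u0 y2u]; exists (t + u); first exact: addr_ge0.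
by rewrite scalerDl opprD addrACA; exact: IH.
Qed.

Lemma coneZ zs k y : 0 <= k -> cone zs y -> cone zs (k *: y).
Proof.
move=> k0; elim: zs y => [|z zs IH] y /=; first by move=> ->; rewrite scaler0.
move=> [t t0 /IH]; rewrite scalerBr scalerA => H.
by exists (k * t) => //; exact: mulr_ge0.
Qed.

Lemma coneZK zs k y : 0 < k -> cone zs (k *: y) -> cone zs y.
Proof.
move=> k0 /(@coneZ _ k^-1); rewrite invr_ge0 scalerA mulVf ?gt_eqF// scale1r.
by apply; exact: ltW.
Qed.

Lemma cone_gen zs z : z \in zs -> cone zs (ivec z).
Proof.
elim: zs => [//|w zs IH]; rewrite inE => /orP[/eqP ->|/IH zs_z] /=.
  by exists 1 => //; rewrite scale1r subrr; exact: cone0.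
by exists 0 => //; rewrite scale0r subr0.
Qed.

(** Serves below as the induction principle for [cone], the set [K] being the claim to be proved. *)
Lemma cone_min (K : set 'rV[R]_d) zs : K 0 ->
  (forall y1 y2, K y1 -> K y2 -> K (y1 + y2)) ->
  (forall k y, 0 <= k -> K y -> K (k *: y)) ->
  (forall z, z \in zs -> K (ivec z)) -> cone zs `<=` K.
Proof.
move=> K0 KD KZ; elim: zs => [_ y -> //|z zs IH] Kzs y /= [t t0 zsy].
rewrite -(subrK (t *: ivec z) y); apply: KD.
  by apply: IH zsy => w wzs; apply: Kzs; rewrite inE wzs orbT.
by apply: KZ => //; apply: Kzs; rewrite mem_head.
Qed.

Lemma cone_sub zs zs' : (forall z, z \in zs -> cone zs' (ivec z)) ->
  cone zs `<=` cone zs'.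
Proof.
by apply: cone_min; [exact: cone0 | exact: coneD | move=> *; exact: coneZ].
Qed.

Lemma lin_le_cone zs a b :
  (forall z, z \in zs -> lin a (ivec z) <= lin b (ivec z)) ->
  forall y, cone zs y -> lin a y <= lin b y.
Proof.
move=> H; apply: cone_min => //=; first by rewrite !lin0r.
- by move=> y1 y2 h1 h2; rewrite !linDr lerD.
- by move=> k y k0 h; rewrite !linZr ler_wpM2l.
Qed.

Lemma lin_ge0_cone zs a :
  (forall z, z \in zs -> 0 <= ilin a z) -> forall y, cone zs y -> 0 <= lin a y.
Proof.
move=> H; apply: cone_min => //=; first by rewrite !lin0r.
- by move=> y1 y2 h1 h2; rewrite !linDr addr_ge0.
- by move=> k y k0 h; rewrite !linZr mulr_ge0.
- by move=> z /H; rewrite lin_ivec ler0z.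
Qed.

(** Clamping a value by the upper and then by the lower bounds gives [t]. This solves for the one
    unknown coefficient in the elimination step below. *)
Lemma separating_value (los ups : seq R) :
  (forall l u, l \in los -> u \in ups -> l <= u) ->
  exists t, (forall l, l \in los -> l <= t) /\ (forall u, u \in ups -> t <= u).
Proof.
elim: los => [|l los IH] H.
  elim: ups {H} => [|u ups [t [_ upt]]]; first by exists 0.
  exists (Num.min u t); split=> // x.
  by rewrite inE ge_min => /orP[/eqP ->|/upt ->]; rewrite ?lexx ?orbT.
have [|t [lot upt]] := IH.
  by move=> l' u l'los; apply: H; rewrite inE l'los orbT.
exists (Num.max l t); split=> x.
  by rewrite inE le_max => /orP[/eqP ->|/lot ->]; rewrite ?lexx ?orbT.
by move=> xups; rewrite ge_max upt // H // mem_head.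
Qed.

(* The projection of a polyhedral cone along [z] is again polyhedral
   (one step of Fourier-Motzkin elimination). *)
Lemma cone_halfspaces zs : exists L : seq 'cV[int]_d,
  forall y, cone zs y <-> forall a, a \in L -> 0 <= lin a y.
Proof.
elim: zs => [|z zs [L LP]].
  exists ([seq delta_mx i 0 | i <- enum 'I_d] ++
          [seq - delta_mx i 0 | i <- enum 'I_d]) => y; split=> [-> a _|H].
    by rewrite lin0r.
  have lind i : lin (delta_mx i 0) y = y 0 i.
    rewrite /lin mxE (bigD1 i) //= !mxE !eqxx mulr1 big1 ?addr0 // => j ji.
    by rewrite !mxE (negbTE ji) mulr0.
  apply/rowP => i; rewrite mxE; apply/eqP; rewrite eq_le -lind.
  rewrite -oppr_ge0 -linNl !H // mem_cat; apply/orP; [left|right];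
    by apply/mapP; exists i; rewrite ?mem_enum.
pose pos := [seq a <- L | 0 <= ilin a z].
pose neg := [seq a <- L | ilin a z < 0].
(* Each [a] in [L] bounds the coefficient of [z]: from above if [a] is positive at [z], from below
   if it is negative. The crossed combinations vanish at [z] and say that lower bounds do not exceed
   upper ones; [pos] itself compares the upper bounds with the lower bound 0. *)
exists (pos ++ [seq ilin a z *: b - ilin b z *: a | a <- pos, b <- neg]) => y.
split=> [[t t0 /LP zsy] a|H].
  have L0 b : b \in L -> t * (ilin b z)%:~R <= lin b y.
    by move=> /zsy; rewrite linBr linZr lin_ivec subr_ge0.
  rewrite mem_cat => /orP[|/allpairsP[[b c] /= []]].
    rewrite mem_filter => /andP[az aL]; apply: le_trans (L0 _ aL).
    by rewrite mulr_ge0 // ler0z.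
  rewrite !mem_filter => /andP[bz bL] /andP[cz cL] ->.
  rewrite linBl !linZl subr_ge0.
  have bz' : 0 <= (ilin b z)%:~R :> R by rewrite ler0z.
  have cz' : (ilin c z)%:~R < 0 :> R by rewrite ltrz0.
  have := ler_wpM2l bz' (L0 _ cL); have := ler_wnM2l (ltW cz') (L0 _ bL).
  move=> h1 h2; apply: (le_trans h1); apply: le_trans h2.
  by rewrite [leLHS]mulrC mulrAC [leLHS]mulrC.
have Hpos a : a \in pos -> 0 <= lin a y by move=> ap; apply: H; rewrite mem_cat ap.
have Hneg a b : a \in pos -> b \in neg ->
    (ilin b z)%:~R * lin a y <= (ilin a z)%:~R * lin b y.
  move=> ap bn; rewrite -subr_ge0 -!linZl -linBl; apply: H; rewrite mem_cat.
  by apply/orP; right; apply/allpairsP; exists (a, b).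
pose ratio a := lin a y / (ilin a z)%:~R.
have sep l u : l \in 0 :: map ratio neg ->
    u \in [seq ratio a | a <- pos & ilin a z != 0] -> l <= u.
  rewrite inE => lP /mapP[a]; rewrite mem_filter => /andP[a0 ap] ->.
  have az : 0 < (ilin a z)%:~R :> R.
    by move: ap; rewrite mem_filter ltr0z lt_def a0 => /andP[->].
  case/orP: lP => [/eqP ->|/mapP[b bn ->]].
    by rewrite divr_ge0 ?Hpos // ltW.
  have bz : (ilin b z)%:~R < 0 :> R.
    by move: bn; rewrite mem_filter ltrz0 => /andP[].
  rewrite ler_pdivlMr // mulrAC ler_ndivrMr // mulrC [leRHS]mulrC.
  exact: Hneg.
have [t [lot upt]] := separating_value sep; exists t.
  by apply: lot; rewrite mem_head.
apply/LP => a aL; rewrite linBr linZr lin_ivec subr_ge0.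
have [az|az|az] := ltgtP (ilin a z) 0.
- have an : a \in neg by rewrite mem_filter az.
  rewrite -ler_ndivrMr ?ltrz0 //; apply: lot.
  by rewrite inE; apply/orP; right; apply/mapP; exists a.
- have ap : a \in pos by rewrite mem_filter ltW.
  rewrite -ler_pdivlMr ?ltr0z //; apply: upt; apply: map_f.
  by rewrite mem_filter ap gt_eqF.
- by rewrite az mulr0; apply: Hpos; rewrite mem_filter az lexx.
Qed.

(** The double description step: keep the generators on the nonnegative side, and for each pair from
    the two sides add the integral nonnegative combination lying on the hyperplane. *)
Definition halfspace_cut a zs : seq 'rV[int]_d :=
  [seq z <- zs | 0 <= ilin a z] ++
  [seq ilin a z *: w - ilin a w *: z |
     z <- [seq z <- zs | 0 <= ilin a z], w <- [seq w <- zs | ilin a w < 0]].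

(** If [y] is [u + v] with [u] and [v] generated on the two sides, then [lin a u *: y] is
    [lin a y *: u] plus [lin a u *: v - lin a v *: u]. The last vector is bilinear in [u] and [v],
    hence generated by the crossings. *)
Lemma cone_halfspace_cutP a zs y :
  cone (halfspace_cut a zs) y <-> cone zs y /\ 0 <= lin a y.
Proof.
set zp := [seq z <- zs | 0 <= ilin a z]; set zn := [seq w <- zs | ilin a w < 0].
pose crs := [seq ilin a z *: w - ilin a w *: z | z <- zp, w <- zn].
have cutE : halfspace_cut a zs = zp ++ crs by [].
have cutl : cone zp `<=` cone (halfspace_cut a zs).
  by apply: cone_sub => z zzp; apply: cone_gen; rewrite mem_cat zzp.
split=> [cy|[zsy ay]].
  split.
    move: y cy; apply: cone_sub => z.
    rewrite mem_cat mem_filter => /orP[/andP[_ ?]|]; first exact: cone_gen.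
    move=> /allpairsP[[u w] /= []]; rewrite !mem_filter.
    move=> /andP[u0 uzs] /andP[w0 wzs] ->.
    rewrite ivecB !ivecZ -scaleNr; apply: coneD; apply: coneZ;
      rewrite ?oppr_ge0 ?ler0z ?lerz0 //; try exact: cone_gen.
    exact: ltW.
  apply: lin_ge0_cone cy => z.
  rewrite mem_cat mem_filter => /orP[/andP[? _] //|].
  move=> /allpairsP[[u w] /= [_ _ ->]].
  by rewrite -scaleNr ilinD !ilinZ mulNr mulrC subrr.
have [u [v [yuv zpu znv]]] : exists u v, [/\ y = u + v, cone zp u & cone zn v].
  move: y zsy {ay}; apply: cone_min => [|y1 y2|k y k0|z zzs] /=.
  - by exists 0, 0; rewrite addr0; split=> //; exact: cone0.
  - move=> [u1 [v1 [-> ? ?]]] [u2 [v2 [-> ? ?]]]; exists (u1 + u2), (v1 + v2).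
    by rewrite addrACA; split=> //; exact: coneD.
  - move=> [u [v [-> ? ?]]]; exists (k *: u), (k *: v).
    by rewrite scalerDr; split=> //; exact: coneZ.
  - have [az|az] := lerP 0 (ilin a z).
      exists (ivec z), 0; rewrite addr0; split=> //; last exact: cone0.
      by apply: cone_gen; rewrite mem_filter az.
    exists 0, (ivec z); rewrite add0r; split=> //; first exact: cone0.
    by apply: cone_gen; rewrite mem_filter az.
(* Either there is nothing to cross, or [0 <= lin a y] forces [0 < lin a u], and [y] may be scaled
   by that factor. *)
have vneg : v = 0 \/ lin a v < 0.
  move: v znv {yuv}; apply: cone_min => [|y1 y2|k v|z] /=; first by left.
  - move=> [->|h1]; rewrite ?add0r // => -[->|h2]; rewrite ?addr0; first by right.
    by right; rewrite linDr; lra.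
  - rewrite le_eqVlt => /orP[/eqP <-|k0]; first by left; rewrite scale0r.
    move=> [->|h]; first by left; rewrite scaler0.
    by right; rewrite linZr pmulr_rlt0.
  - by rewrite mem_filter => /andP[az _]; right; rewrite lin_ivec ltrz0.
case: vneg => [v0|vneg]; first by apply: cutl; rewrite yuv v0 addr0.
have ucross w : w \in zn -> cone crs (lin a u *: ivec w - (ilin a w)%:~R *: u).
  move=> wzn; move: u zpu {yuv}; apply: cone_min => [|y1 y2|k u k0|z zzp] /=.
  - by rewrite lin0r scale0r scaler0 subrr; exact: cone0.
  - by rewrite linDr scalerDl scalerDr opprD addrACA; exact: coneD.
  - rewrite linZr -scalerA [_ *: (k *: _)]scalerA mulrC -scalerA -scalerBr.
    exact: coneZ.
  - rewrite lin_ivec -!ivecZ -ivecB; apply: cone_gen.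
    by apply/allpairsP; exists (z, w).
have : cone crs (lin a u *: v - lin a v *: u).
  move: v znv {vneg yuv}; apply: cone_min => [|y1 y2|k v k0|z zzn] /=.
  - by rewrite lin0r scale0r scaler0 subrr; exact: cone0.
  - by rewrite linDr scalerDl scalerDr opprD addrACA; exact: coneD.
  - rewrite linZr -scalerA [_ *: (k *: _)]scalerA mulrC -scalerA -scalerBr.
    exact: coneZ.
  - by rewrite lin_ivec; exact: ucross.
move=> uvc; have au : 0 < lin a u by move: ay; rewrite yuv linDr; lra.
apply: (coneZK au); rewrite yuv.
rewrite (_ : _ *: _ = lin a (u + v) *: u + (lin a u *: v - lin a v *: u)).
  apply: coneD.
    by apply: coneZ; [rewrite -yuv | exact: cutl].
  by move: uvc; apply: cone_sub => z zc; apply: cone_gen; rewrite mem_cat zc orbT.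
by rewrite linDr scalerDl scalerDr addrACA subrr addr0.
Qed.

End Cones.

(** * Polyhedral cells and lattice-group terms *)

(** The language of unital l-groups, with [LOne] for the order-unit. Kept as syntax, terms can be
    evaluated at points and in any unital l-group, and substituted into each other. *)
Inductive lterm (n : nat) :=
  | LVar of 'I_n
  | LOne
  | LAdd of lterm n & lterm n
  | LOpp of lterm n
  | LJoin of lterm n & lterm n
  | LMeet of lterm n & lterm n.
Arguments LOne {n}.

HB.instance Definition _ n := gen_eqMixin (lterm n).

Section Cells.
Variables (R : realType) (n : nat).
Implicit Types (z w : 'rV[int]_(n + 1)) (zs : seq 'rV[int]_(n + 1)).
Implicit Types (zss : seq (seq 'rV[int]_(n + 1))) (a b : 'cV[int]_(n + 1)).
Implicit Types (x : 'rV[R]_n) (t : lterm n) (F : 'rV[R]_n -> R).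

Definition hx x : 'rV[R]_(n + 1) := row_mx x 1.
Definition last_coord : 'cV[int]_(n + 1) := col_mx 0 1.
Definition positive zs : Prop := forall z, z \in zs -> 0 < ilin last_coord z.

(* The points x such that (x, 1) lies in the cone; it is a rational polytope
   when all generators have positive last coordinate. *)
Definition cell zs : set 'rV[R]_n := [set x | cone zs (hx x)].

Lemma lin_last_hx x : lin last_coord (hx x) = 1.
Proof.
by rewrite /lin map_col_mx mul_row_col map_mx0 mulmx0 add0r map_mx1 mulmx1 mxE.
Qed.

Lemma lin_last (y : 'rV[R]_(n + 1)) : lin last_coord y = rsubmx y 0 0.
Proof.
rewrite -[y in LHS]hsubmxK /lin map_col_mx mul_row_col map_mx0 mulmx0 add0r.
by rewrite map_mx1 mulmx1.
Qed.

Lemma hx_normalize (y : 'rV[R]_(n + 1)) : lin last_coord y != 0 ->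
  y = lin last_coord y *: hx ((lin last_coord y)^-1 *: lsubmx y).
Proof.
move=> y0; rewrite /hx scale_row_mx scalerA divff // scale1r -[LHS]hsubmxK.
congr (row_mx _ _); rewrite lin_last; apply/matrixP => i j.
by rewrite !ord1 !mxE mulr1.
Qed.

Lemma cell_cone zs (y : 'rV[R]_(n + 1)) : cone zs y -> 0 < lin last_coord y ->
  exists2 x, cell zs x & y = lin last_coord y *: hx x.
Proof.
move=> zsy y0; have yE := hx_normalize (lt0r_neq0 y0).
exists ((lin last_coord y)^-1 *: lsubmx y) => //.
by apply: (coneZK y0); rewrite -yE.
Qed.

Lemma cell_gen zs z : positive zs -> z \in zs ->
  exists2 x, cell zs x & ivec R z = (ilin last_coord z)%:~R *: hx x.
Proof.
move=> pzs zzs; rewrite -lin_ivec; apply: cell_cone; first exact: cone_gen.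
by rewrite lin_ivec ltr0z; exact: pzs.
Qed.

(** Subdivision in a weak sense: only the union of the pieces counts. They may overlap and need not
    meet in faces, so that refinements compose freely. *)
Definition splits (Pr : seq 'rV[int]_(n + 1) -> Prop) zs : Prop :=
  exists zss, (forall x, cell zs x <-> exists2 zs', zs' \in zss & cell zs' x) /\
    forall zs', zs' \in zss -> positive zs' /\ Pr zs'.

Definition hereditary (Pr : seq 'rV[int]_(n + 1) -> Prop) : Prop :=
  forall zs zs', cell zs' `<=` cell zs -> Pr zs -> Pr zs'.

Lemma splits_id (Pr : seq 'rV[int]_(n + 1) -> Prop) zs :
  positive zs -> Pr zs -> splits Pr zs.
Proof.
move=> pzs Pzs; exists [:: zs]; split=> [x|zs'].
  split=> [zsx|[zs']]; first by exists zs; rewrite ?mem_head.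
  by rewrite inE => /eqP ->.
by rewrite inE => /eqP ->.
Qed.

Lemma splits_bind (Pr Pr' : seq 'rV[int]_(n + 1) -> Prop) zs : splits Pr zs ->
  (forall zs', cell zs' `<=` cell zs -> positive zs' -> Pr zs' ->
     splits Pr' zs') ->
  splits Pr' zs.
Proof.
move=> [zss [zsE zssP]] H.
have /choice[f fP] : forall zs', exists zss', zs' \in zss ->
    (forall x, cell zs' x <-> exists2 zs'', zs'' \in zss' & cell zs'' x) /\
    forall zs'', zs'' \in zss' -> positive zs'' /\ Pr' zs''.
  move=> zs'; have [zin|_] := boolP (zs' \in zss); last by exists [::].
  have [pz Pz] := zssP _ zin.
  have [|zss' H'] := H zs' _ pz Pz; last by exists zss'.
  by move=> x zx; apply/zsE; exists zs'.
exists (flatten (map f zss)); split=> [x|zs''].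
  split=> [/zsE[zs' zin zx]|[zs'' /flatten_mapP[zs' zin fz] zx]].
    have [/(_ x)[/(_ zx)[zs'' fz zx'] _] _] := fP _ zin.
    by exists zs'' => //; apply/flatten_mapP; exists zs'.
  apply/zsE; exists zs' => //; have [/(_ x)[_ h] _] := fP _ zin.
  by apply: h; exists zs''.
by move=> /flatten_mapP[zs' zin fz]; have [_] := fP _ zin; apply.
Qed.

Lemma splits_all (I : eqType) (r : seq I)
    (Pr : I -> seq 'rV[int]_(n + 1) -> Prop) zs :
  (forall i, hereditary (Pr i)) ->
  (forall i zs, positive zs -> splits (Pr i) zs) ->
  positive zs -> splits (fun zs' => forall i, i \in r -> Pr i zs') zs.
Proof.
move=> her H pzs; elim: r => [|i r IH]; first exact: splits_id.
apply: splits_bind IH _ => zs1 _ pzs1 P1.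
apply: splits_bind (H i _ pzs1) _ => zs2 sub2 pzs2 P2.
apply: splits_id => // j; rewrite inE => /orP[/eqP -> //|jr].
exact: her sub2 (P1 j jr).
Qed.

Definition sign_definite a zs : Prop :=
  (forall x, cell zs x -> 0 <= lin a (hx x)) \/
  (forall x, cell zs x -> lin a (hx x) <= 0).

Lemma sign_definite_hereditary a : hereditary (sign_definite a).
Proof. by move=> zs zs' sub [H|H]; [left|right] => x /sub /H. Qed.

Lemma positive_halfspace_cut a zs : positive zs -> positive (halfspace_cut a zs).
Proof.
move=> pzs z; rewrite mem_cat mem_filter => /orP[/andP[_ /pzs //]|].
move=> /allpairsP[[u w] /= []]; rewrite !mem_filter.
move=> /andP[u0 /pzs uzs] /andP[w0 /pzs wzs] ->.
rewrite -scaleNr ilinD !ilinZ; apply: ltr_wpDl; first by rewrite mulr_ge0 // ltW.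
by rewrite mulr_gt0 // oppr_gt0.
Qed.

Lemma splits_sign a zs : positive zs -> splits (sign_definite a) zs.
Proof.
move=> pzs; exists [:: halfspace_cut a zs; halfspace_cut (- a) zs]; split=> [x|zs'].
  split=> [zsx|[zs']].
    have [ax|ax] := lerP 0 (lin a (hx x)).
      by exists (halfspace_cut a zs); [rewrite mem_head | apply/cone_halfspace_cutP].
    exists (halfspace_cut (- a) zs); first by rewrite !inE eqxx orbT.
    by apply/cone_halfspace_cutP; rewrite linNl oppr_ge0 ltW.
  by rewrite !inE => /orP[] /eqP -> /cone_halfspace_cutP[].
rewrite !inE => /orP[] /eqP ->; split; try exact: positive_halfspace_cut.
  by left => x /cone_halfspace_cutP[].
by right => x /cone_halfspace_cutP[_]; rewrite linNl oppr_ge0.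
Qed.

Fixpoint teval x t : R :=
  match t with
  | LVar i => x 0 i
  | LOne => 1
  | LAdd t1 t2 => teval x t1 + teval x t2
  | LOpp t1 => - teval x t1
  | LJoin t1 t2 => Num.max (teval x t1) (teval x t2)
  | LMeet t1 t2 => Num.min (teval x t1) (teval x t2)
  end.

Definition affine_on F zs : Prop :=
  exists a, forall x, cell zs x -> F x = lin a (hx x).

Lemma affine_on_hereditary F : hereditary (affine_on F).
Proof. by move=> zs zs' sub [a H]; exists a => x /sub /H. Qed.

Lemma lin_hx (A : 'M[int]_(n, 1)) (b : 'rV[int]_1) x :
  lin (col_mx A b) (hx x) = affineZ A b x 0 0.
Proof. by rewrite /lin /affineZ map_col_mx mul_row_col mul1mx. Qed.

Lemma lin_var i x : lin (col_mx (delta_mx i 0) 0) (hx x) = x 0 i.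
Proof.
rewrite lin_hx /affineZ map_mx0 addr0 mxE (bigD1 i) //= !mxE !eqxx mulr1.
by rewrite big1 ?addr0 // => j ji; rewrite !mxE (negbTE ji) mulr0.
Qed.

Lemma splits_imp (Pr Pr' : seq 'rV[int]_(n + 1) -> Prop) zs :
  (forall zs', Pr zs' -> Pr' zs') -> splits Pr zs -> splits Pr' zs.
Proof.
move=> H [zss [zssE zssP]]; exists zss; split=> // zs' /zssP[pz Pz].
by split=> //; exact: H.
Qed.

Lemma splits_term t zs : positive zs -> splits (affine_on (teval^~ t)) zs.
Proof.
(* Once both subterms are affine on a cell, a further cut by the difference of their forms lets
   [max] and [min] select the same one on the whole cell. *)
have both t1 t2 :
    (forall zs, positive zs -> splits (affine_on (teval^~ t1)) zs) ->
    (forall zs, positive zs -> splits (affine_on (teval^~ t2)) zs) ->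
    forall zs, positive zs -> splits (fun zs' => exists a b,
      [/\ forall x, cell zs' x -> teval x t1 = lin a (hx x),
          forall x, cell zs' x -> teval x t2 = lin b (hx x) &
          sign_definite (a - b) zs']) zs.
  move=> IH1 IH2 zs0 pzs0; apply: splits_bind (IH1 _ pzs0) _ => zs1 _ pzs1 [a aP].
  apply: splits_bind (IH2 _ pzs1) _ => zs2 sub2 pzs2 [b bP].
  apply: splits_bind (splits_sign (a - b) pzs2) _ => zs3 sub3 pzs3 abP.
  apply: splits_id => //; exists a, b; split=> // x x3.
    by apply: aP; apply: sub2; apply: sub3.
  by apply: bP; apply: sub3.
elim: t zs => [i||t1 IH1 t2 IH2|t IH|t1 IH1 t2 IH2|t1 IH1 t2 IH2] zs pzs.
- apply: splits_id => //; exists (col_mx (delta_mx i 0) 0) => x _ /=.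
  by rewrite lin_var.
- by apply: splits_id => //; exists last_coord => x _ /=; rewrite lin_last_hx.
- apply: splits_imp (both _ _ IH1 IH2 _ pzs) => zs' [a [b [aP bP _]]].
  by exists (a + b) => x xz /=; rewrite linDl aP // bP.
- apply: splits_imp (IH _ pzs) => zs' [a aP]; exists (- a) => x xz /=.
  by rewrite linNl aP.
- apply: splits_imp (both _ _ IH1 IH2 _ pzs) => zs' [a [b [aP bP []ab]]].
    exists a => x xz /=; rewrite aP // bP //; apply/max_idPl.
    by rewrite -subr_ge0 -linBl ab.
  exists b => x xz /=; rewrite aP // bP //; apply/max_idPr.
  by rewrite -subr_le0 -linBl ab.
- apply: splits_imp (both _ _ IH1 IH2 _ pzs) => zs' [a [b [aP bP []ab]]].
    exists b => x xz /=; rewrite aP // bP //; apply/min_idPr.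
    by rewrite -subr_ge0 -linBl ab.
  exists a => x xz /=; rewrite aP // bP //; apply/min_idPl.
  by rewrite -subr_le0 -linBl ab.
Qed.

Definition term_fun F : Prop := exists t, forall x, F x = teval x t.

Lemma term_funD F G : term_fun F -> term_fun G -> term_fun (fun x => F x + G x).
Proof. by move=> [t tP] [u uP]; exists (LAdd t u) => x /=; rewrite tP uP. Qed.

Lemma term_funN F : term_fun F -> term_fun (fun x => - F x).
Proof. by move=> [t tP]; exists (LOpp t) => x /=; rewrite tP. Qed.

Lemma term_fun_max F G :
  term_fun F -> term_fun G -> term_fun (fun x => Num.max (F x) (G x)).
Proof. by move=> [t tP] [u uP]; exists (LJoin t u) => x /=; rewrite tP uP. Qed.

Lemma term_fun1 : term_fun (fun=> 1).
Proof. by exists LOne. Qed.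

Lemma term_fun0 : term_fun (fun=> 0).
Proof. by exists (LAdd LOne (LOpp LOne)) => x /=; rewrite subrr. Qed.

Lemma term_funMn F (k : nat) : term_fun F -> term_fun (fun x => F x *+ k).
Proof.
move=> [t tP]; elim: k => [|k IH]; first exact: term_fun0.
have [u uP] := term_funD (ex_intro _ t tP) IH; exists u => x.
by rewrite mulrS uP.
Qed.

Lemma term_funMz F (k : int) : term_fun F -> term_fun (fun x => F x *~ k).
Proof.
by case: k => k tF; [exact: term_funMn | exact/term_funN/term_funMn].
Qed.

Lemma term_fun_sum (I : eqType) (r : seq I) (F : I -> 'rV[R]_n -> R) :
  (forall i, i \in r -> term_fun (F i)) ->
  term_fun (fun x => \sum_(i <- r) F i x).
Proof.
elim: r => [|i r IH] H.
  by have [t tP] := term_fun0; exists t => x; rewrite big_nil.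
have [|t tP] := term_funD (H i (mem_head _ _)) (IH _).
  by move=> j jr; apply: H; rewrite inE jr orbT.
by exists t => x; rewrite big_cons tP.
Qed.

Lemma term_fun_lin a : term_fun (fun x => lin a (hx x)).
Proof.
have [t tP] : term_fun
    (fun x => \sum_(i <- enum 'I_n) x 0 i *~ usubmx a i 0 + 1 *~ dsubmx a 0 0).
  apply: term_funD; last exact/term_funMz/term_fun1.
  by apply: term_fun_sum => i _; apply: term_funMz; exists (LVar i).
exists t => x; rewrite -tP -[in LHS](vsubmxK a) lin_hx /affineZ mxE big_enum /=.
rewrite mxE [X in _ + X]mxE; congr (_ + _).
by apply: eq_bigr => i _; rewrite mxE mulrzr.
Qed.

(** The term is the sum of the negative parts of finitely many functionals that define the cone. *)
Lemma rational_cell_term zs : exists t, forall x,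
  0 <= teval x t /\ (teval x t = 0 <-> cell zs x).
Proof.
have [L LP] := cone_halfspaces R zs.
have [t tP] : term_fun (fun x => \sum_(a <- L) Num.max 0 (lin (- a) (hx x))).
  apply: term_fun_sum => a _; apply: term_fun_max; first exact: term_fun0.
  exact: term_fun_lin.
have pos0 a x : 0 <= Num.max 0 (lin (- a) (hx x)) by rewrite le_max lexx.
exists t => x; rewrite -tP; split; first by rewrite sumr_ge0.
rewrite /cell /= LP; split=> [/eqP|H].
  rewrite psumr_eq0 // => /allP H a /H /= /eqP aE.
  by rewrite -oppr_le0 -linNl -[leRHS]aE le_max lexx orbT.
rewrite big_seq big1 // => a /H; rewrite -oppr_le0 -linNl => ax.
exact/max_idPl.
Qed.

(** For nonnegative terms, the minimum corresponds to the union of zero sets; [LOne] covers the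
    empty union. *)
Lemma rational_cells_term zss : exists t, forall x,
  0 <= teval x t /\ (teval x t = 0 <-> exists2 zs, zs \in zss & cell zs x).
Proof.
elim: zss => [|zs zss [t tP]].
  by exists LOne => x /=; split=> //; split=> [/eqP|[]//]; rewrite oner_eq0.
have [u uP] := rational_cell_term zs; exists (LMeet u t) => x /=.
have [t0 tE] := tP x; have [u0 uE] := uP x; rewrite le_min t0 u0; split=> //.
split=> [|[zs']].
  have [ut|tu] := leP (teval x u) (teval x t).
    by move=> /uE zsx; exists zs; rewrite ?mem_head.
  by move=> /tE[zs' zin zx]; exists zs'; rewrite ?inE ?zin ?orbT.
rewrite inE => /orP[/eqP ->|zin zx].
  by move=> /uE ->; apply/min_idPl.
by rewrite (tE.2 _); [apply/min_idPr | exists zs'].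
Qed.

Lemma uniform_bound (I : eqType) (r : seq I) (P : I -> nat -> Prop) :
  (forall i M N, i \in r -> (M <= N)%N -> P i M -> P i N) ->
  (forall i, i \in r -> exists N, P i N) ->
  exists N, forall i, i \in r -> P i N.
Proof.
elim: r => [|i r IH] mono H; first by exists 0%N.
have [M PM] := H i (mem_head _ _).
have [k M' N kr|j jr|N PN] := IH.
- by apply: mono; rewrite inE kr orbT.
- by apply: H; rewrite inE jr orbT.
exists (maxn M N) => j jir; have := jir; rewrite inE => /orP[/eqP ji|jr].
  by rewrite ji in jir *; apply: mono jir (leq_maxl _ _) PM.
exact: mono jir (leq_maxr _ _) (PN _ jr).
Qed.

(** A Lojasiewicz-type inequality. On a piece where [t] is linear it suffices to compare at the
    finitely many generators: where [t] vanishes the hypothesis applies, elsewhere a large [N]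
    exists by the Archimedean property. *)
Lemma term_growth t zs a : positive zs -> (forall x, 0 <= teval x t) ->
  (forall x, cell zs x -> teval x t = 0 -> lin a (hx x) <= 0) ->
  exists N : nat, forall x, cell zs x -> lin a (hx x) <= teval x t *+ N.
Proof.
move=> pzs t0 H; have [zss [zsE zssP]] := splits_term t pzs.
have [N NP] : exists N, forall zs', zs' \in zss ->
    forall x, cell zs' x -> lin a (hx x) <= teval x t *+ N.
  apply: uniform_bound => [zs' M N _ MN MP x /MP ax|zs' zin].
    by apply: le_trans ax _; rewrite ler_wpMn2l.
  have [pz [b bP]] := zssP _ zin.
  have bge0 z : z \in zs' -> 0 <= lin b (ivec R z).
    move=> zz; have [y yz' ->] := cell_gen pz zz.
    by rewrite linZr -bP // mulr_ge0 // ler0z ltW // pz.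
  have [N NP] : exists N, forall z, z \in zs' ->
      lin a (ivec R z) <= lin b (ivec R z) *+ N.
    apply: uniform_bound => [z M N zz MN MP|z zz].
      by apply: le_trans MP _; rewrite ler_wpMn2l // bge0.
    have [x xz' zE] := cell_gen pz zz.
    have [b0|b0] := eqVneq (lin b (ivec R z)) 0.
      exists 0%N; rewrite mulr0n zE linZr mulr_ge0_le0 // ?ler0z; first exact/ltW/pz.
      apply: H; first by apply/zsE; exists zs'.
      move/eqP: b0; rewrite zE linZr mulf_eq0 intr_eq0 gt_eqF ?pz //= => /eqP.
      by rewrite bP.
    have bz : 0 < lin b (ivec R z) by rewrite lt_def b0 bge0.
    have := archi_boundP (normr_ge0 (lin a (ivec R z) / lin b (ivec R z))).
    set N := Num.bound _ => /ltW NP; exists N.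
    rewrite -mulr_natl -ler_pdivrMr //; apply: le_trans NP; exact: ler_norm.
  exists N => x zx; rewrite bP // -mulr_natl -[N%:R]/(N%:~R) -linZl.
  apply: lin_le_cone zx => z zz.
  by rewrite linZl mulr_natl NP.
exists N => x /zsE[zs' zin zx].
exact: NP zin _ zx.
Qed.

End Cells.

(** * Continuous piecewise affine functions and terms *)

Section PiecewiseLinear.
Variables (R : realType) (n : nat).
Implicit Types (zs : seq 'rV[int]_(n + 1)) (zss : seq (seq 'rV[int]_(n + 1))).
Implicit Types (a b : 'cV[int]_(n + 1)) (x : 'rV[R]_n) (t : lterm n).

Definition cells zss : set 'rV[R]_n := [set x | exists2 zs, zs \in zss & cell zs x].

Lemma rV_cvg (T : Type) (F : set_system T) {FF : Filter F} m
    (g : T -> 'rV[R]_m) (l : 'rV[R]_m) :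
  (forall i, (fun u => g u 0 i) @ F --> l 0 i) -> g @ F --> l.
Proof.
move=> H B [P Pnbhs PB].
have : \forall u \near F, forall i, P 0 i (g u 0 i).
  by apply: filter_forall => i; apply: H; exact: Pnbhs.
by apply: filterS => u Pu; apply: PB => i j; rewrite ord1.
Qed.

Lemma teval_continuous t : continuous (fun x => teval x t).
Proof.
elim: t => [i||t1 IH1 t2 IH2|t IH|t1 IH1 t2 IH2|t1 IH1 t2 IH2] x.
- exact: coord_continuous.
- exact: (@cst_continuous _ _ (1 : R)).
- exact: (@continuousD R R^o _ (fun x => teval x t1) (fun x => teval x t2) x
           (IH1 x) (IH2 x)).
- exact: (@continuousN R R^o _ (fun x => teval x t) x (IH x)).
- exact: (@continuous_max R _ (fun x => teval x t1) (fun x => teval x t2) x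
           (IH1 x) (IH2 x)).
- exact: (@continuous_min R _ (fun x => teval x t1) (fun x => teval x t2) x
           (IH1 x) (IH2 x)).
Qed.

Lemma foldr_meet_ge v x t0 (ts : seq (lterm n)) :
  (v <= teval x (foldr (@LMeet n) t0 ts)) =
  (v <= teval x t0) && all (fun t => v <= teval x t) ts.
Proof. by elim: ts => [|t ts IH] /=; rewrite ?andbT // le_min IH andbCA. Qed.

Lemma foldr_join_le v x t0 (ts : seq (lterm n)) :
  (teval x (foldr (@LJoin n) t0 ts) <= v) =
  (teval x t0 <= v) && all (fun t => teval x t <= v) ts.
Proof. by elim: ts => [|t ts IH] /=; rewrite ?andbT // ge_max IH andbCA. Qed.

(* With g_pq >= f on the cell p and g_pq <= f on the cell q, the term
   max_p min_q g_pq coincides with f on all cells. *)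
Lemma cells_term (f : 'rV[R]_n -> R) zss :
  (forall zs, zs \in zss -> positive zs /\ affine_on f zs) ->
  exists t, forall x, cells zss x -> f x = teval x t.
Proof.
have [->|[p0 p0in]] : zss = [::] \/ exists p0, p0 \in zss.
- by case: zss => [|p0 zss']; [left | right; exists p0; rewrite mem_head].
- by exists LOne => x [].
move=> H.
have /choice[g gP] : forall pq : seq 'rV[int]_(n + 1) * seq 'rV[int]_(n + 1),
    exists t, pq.1 \in zss -> pq.2 \in zss ->
      (forall x, cell pq.1 x -> f x <= teval x t) /\
      (forall x, cell pq.2 x -> teval x t <= f x).
  move=> [p q] /=.
  have [pin|] := boolP (p \in zss); last by exists LOne.
  have [qin|] := boolP (q \in zss); last by exists LOne.
  have [pp [a aP]] := H _ pin; have [pq [b bP]] := H _ qin.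
  have [d dP] := rational_cell_term R q.
  (* The penalty [d] vanishes exactly on [q], and at points of [p] in [q] both [a] and [b] give [f].
     So [b] plus a multiple of [d] dominates [a] on [p] and is still [b] on [q]. *)
  have [|x xp|N NP] := @term_growth R n d p (a - b) pp.
  - by move=> x; have [] := dP x.
  - by move=> /(dP x).2 xq; rewrite linBl -aP // -bP // subrr.
  have [t tP] : @term_fun R n (fun x => lin b (hx x) + teval x d *+ N).
    apply: term_funD; first exact: term_fun_lin.
    by apply: term_funMn; exists d.
  exists t => _ _; split=> x xc; rewrite -tP.
    by have := NP x xc; rewrite linBl lerBlDl aP.
  by rewrite (dP x).2.2 // mul0rn addr0 bP.
(* The start values [g (p, p)] and, in the next fold, [inner p0] already occur in their lists for
   [p] in [zss], so they alter neither the minimum nor the maximum. *)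
pose inner p := foldr (@LMeet n) (g (p, p)) [seq g (p, q) | q <- zss].
exists (foldr (@LJoin n) (inner p0) [seq inner p | p <- zss]) => x [p pin xp].
have innerle p' : p' \in zss -> teval x (inner p') <= f x.
  move=> p'in; have := lexx (teval x (inner p')).
  rewrite {2}/inner foldr_meet_ge => /andP[_ /allP/(_ (g (p', p)))].
  rewrite (map_f (fun q => g (p', q))) // => /(_ isT) /le_trans; apply.
  by have [_] := gP (p', p) p'in pin; apply.
apply/le_anti/andP; split; last first.
  rewrite foldr_join_le innerle //=; apply/allP => _ /mapP[q qin ->].
  exact: innerle.
have : f x <= teval x (inner p).
  rewrite foldr_meet_ge; have gp q : q \in zss -> f x <= teval x (g (p, q)).
    by move=> qin; have [h _] := gP (p, q) pin qin; exact: h.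
  by rewrite gp //; apply/allP => _ /mapP[q qin ->]; exact: gp.
move=> /le_trans; apply.
have := lexx (teval x (foldr (@LJoin n) (inner p0) [seq inner p | p <- zss])).
rewrite {1}foldr_join_le => /andP[_ /allP]; apply.
exact: map_f.
Qed.

Lemma hx_segment x y (u : R) :
  hx (y + u *: (x - y)) = (1 - u) *: hx y + u *: hx x.
Proof.
rewrite /hx !scale_row_mx add_row_mx -scalerDl subrK scale1r.
by rewrite scalerBr scalerBl scale1r addrA addrAC.
Qed.

Lemma cell_segment zs x y (u : R) : 0 <= u <= 1 -> cell zs x -> cell zs y ->
  cell zs (y + u *: (x - y)).
Proof.
move=> /andP[u0 u1] zx zy; rewrite /cell /= hx_segment.
by apply: coneD; apply: coneZ; rewrite ?subr_ge0.
Qed.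

Lemma segment_continuous zs x y (f : 'rV[R]_n -> R) :
  {within cell zs, continuous f} -> cell zs x -> cell zs y ->
  {within `[0, 1]%classic, continuous (fun u : R => f (y + u *: (x - y)))}.
Proof.
move=> /subspace_continuousP cf zx zy; apply/subspace_continuousP => u u01.
have zu : cell zs (y + u *: (x - y)).
  by apply: cell_segment => //; move: u01; rewrite /= in_itv.
have gcts : (fun u : R => y + u *: (x - y)) @ nbhs u --> y + u *: (x - y).
  apply: rV_cvg => i; under eq_fun do rewrite !mxE.
  rewrite !mxE; apply: (@cvgD R R^o); first exact: cvg_cst.
  by apply: (@cvgM R); [exact: cvg_id | exact: cvg_cst].
move=> B /(cf _ zu) Bf.
have near_u : nbhs u [set u' : R | cell zs (y + u' *: (x - y)) ->
    B (f (y + u' *: (x - y)))] := gcts [set x' | cell zs x' -> B (f x')] Bf.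
suff : nbhs u [set u' | `[0, 1]%classic u' -> B (f (y + u' *: (x - y)))] by [].
apply: (@filterS _ (nbhs u) _ _ _ _ near_u) => u' Bu' u'01; apply: Bu'.
by apply: cell_segment => //; move: u'01; rewrite /= in_itv.
Qed.

Lemma positive_lower_bound (r : seq R) :
  exists2 e, 0 < e & forall c, c \in r -> 0 < c -> e < c.
Proof.
elim: r => [|c r [e e0 eP]]; first by exists 1.
have [c0|c0] := lerP c 0.
  exists e => // c'; rewrite inE => /orP[/eqP ->|/eP //].
  by rewrite ltNge c0.
exists (Num.min e (c / 2)); first by rewrite lt_min e0 divr_gt0.
move=> c'; rewrite inE gt_min => /orP[/eqP -> _|c'r c'0].
  by rewrite ltr_pdivrMr // ltr_pMr // (ltr_nat _ 1 2) orbT.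
by rewrite eP.
Qed.

(* On a cell where the pieces are weakly ordered, two pieces that agree at the
   barycenter of the generators agree everywhere.  A piece different from the one
   taken at the barycenter therefore stays away from it on half-open segments
   issuing from there, and f cannot switch by the intermediate value theorem. *)
Lemma continuous_piecewise_cell (f : 'rV[R]_n -> R) zs (r : seq 'cV[int]_(n + 1)) :
  positive zs -> {within cell zs, continuous f} ->
  (forall x, cell zs x -> exists2 a, a \in r & f x = lin a (hx x)) ->
  (forall a b, a \in r -> b \in r -> sign_definite R (a - b) zs) ->
  affine_on f zs.
Proof.
move=> pzs cf fr sgn.
(* Without generators the cone is the origin, which is never of the form [hx x]; the cell is empty
   and any form will do. *)
have [zs0|zs0] := eqVneq zs [::].
  exists 0 => x; rewrite zs0 /cell /= => hx0.
  by have := lin_last_hx x; rewrite hx0 lin0r => /eqP; rewrite eq_sym oner_eq0.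
pose bary := \sum_(z <- zs) ivec R z.
have linbary a : lin a bary = \sum_(z <- zs) lin a (ivec R z).
  by rewrite /bary; elim/big_ind2: _ => [|u v w x <- <-|//]; rewrite ?lin0r ?linDr.
have cbary : cone zs bary.
  rewrite /bary big_seq; elim/big_ind: _; [exact: cone0 | exact: coneD |].
  by move=> z; exact: cone_gen.
have lbary : 0 < lin (last_coord n) bary.
  rewrite linbary; case: zs zs0 pzs {cf fr sgn bary linbary cbary} => //= z zs _ pzs.
  rewrite big_cons; apply: ltr_wpDr; last by rewrite lin_ivec ltr0z pzs // mem_head.
  rewrite big_seq sumr_ge0 // => w wzs.
  by rewrite lin_ivec ler0z ltW // pzs // inE wzs orbT.
have [x0 zx0 baryE] := cell_cone cbary lbary.
have [a ar fx0] := fr x0 zx0.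
exists a => y zy; apply/eqP/negPn/negP => fy.
(* [s] is the sign of the discrepancy at [y]; multiplying by it puts [f] above [a] there. *)
have [s [s1 sf]] : exists s : int, (s = 1 \/ s = -1) /\
    0 < s%:~R * (f y - lin a (hx y)).
  move: fy; rewrite neq_lt => /orP[fy|fy].
    exists (-1); split; first by right.
    by rewrite mulrN1z mulN1r opprB subr_gt0.
  by exists 1; split; [left | rewrite mul1r subr_gt0].
pose c b := s *: (b - a).
have sgnc b : b \in r -> (forall x, cell zs x -> lin (c b) (hx x) <= 0) \/
    (0 < lin (c b) (hx x0) /\ forall x, cell zs x -> 0 <= lin (c b) (hx x)).
  move=> br.
  have : sign_definite R (c b) zs.
    rewrite /c; case: s1 => ->; first by rewrite scale1r; exact: sgn.
    by rewrite scaleN1r opprB; exact: sgn.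
  move=> [cge|cle]; last by left.
  (* If [c b] vanishes at the barycenter, its nonnegative values at the generators sum to 0, so all
     of them are 0. *)
  have [c0|c0] := eqVneq (lin (c b) (hx x0)) 0; last first.
    by right; split=> //; rewrite lt_def c0 cge.
  left => x zx; rewrite -[leRHS](lin0r R (c b)).
  have cz z : z \in zs -> 0 <= lin (c b) (ivec R z).
    move=> zzs; have [x' zx' ->] := cell_gen R pzs zzs.
    by rewrite linZr mulr_ge0 ?cge // ler0z ltW // pzs.
  have : lin (c b) bary = 0 by rewrite baryE linZr c0 mulr0.
  rewrite linbary big_seq => /eqP; rewrite psumr_eq0 // => /allP cz0.
  rewrite lin0r (_ : 0 = lin 0 (hx x)); last by rewrite /lin map_mx0 mulmx0 mxE.
  apply: lin_le_cone zx => z zzs; have := cz0 z zzs; rewrite zzs /= => /eqP ->.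
  by rewrite /lin map_mx0 mulmx0 mxE.
(* By [sgnc] a piece has gap at most 0 over [a], or gap above [e] at [x0] and hence above [e * u]
   along the segment from [y]. The gap of [f] is positive at [u = 0] and 0 at [u = 1], so it meets
   the line [e * u] at some [u > 0], which no piece can do. *)
have [e e0 eP] := positive_lower_bound [seq lin (c b) (hx x0) | b <- r].
pose gam (u : R) := y + u *: (x0 - y).
have gam0 : gam 0 = y by rewrite /gam scale0r addr0.
have gam1 : gam 1 = x0 by rewrite /gam scale1r addrC subrK.
pose psi (u : R) := s%:~R * (f (gam u) - lin a (hx (gam u))) - e * u.
have psi_cont : {within `[0, 1]%classic, continuous psi}.
  apply/subspace_continuousP => u u01.
  have cA : (fun u => f (gam u)) @ within `[0, 1]%classic (nbhs u) --> f (gam u).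
    by have /subspace_continuousP := segment_continuous cf zx0 zy; exact.
  have [t tP] := @term_fun_lin R n a.
  have cB : (fun u => lin a (hx (gam u))) @ within `[0, 1]%classic (nbhs u) -->
      lin a (hx (gam u)).
    have cBt : {within cell zs, continuous (fun x => lin a (hx x))}.
      under eq_fun do rewrite tP.
      exact/continuous_subspaceT/teval_continuous.
    by have /subspace_continuousP := segment_continuous cBt zx0 zy; exact.
  apply: (@cvgB R R^o); last first.
    apply: cvg_within_filter; apply: (@cvgM R); [exact: cvg_cst | exact: cvg_id].
  apply: (@cvgM R); first exact: cvg_cst.
  exact: (@cvgB R R^o).
have psi0 : psi 0 = s%:~R * (f y - lin a (hx y)) by rewrite /psi gam0 mulr0 subr0.
have psi1 : psi 1 = - e by rewrite /psi gam1 fx0 subrr mulr0 mulr1 add0r.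
have [u u01 psiu] : exists2 u, u \in `[0, 1] & psi u = 0.
  apply: IVT => //; rewrite psi0 psi1 ge_min le_max oppr_le0.
  by rewrite (ltW e0) (ltW sf) orbT.
have /andP[u0 u1] : 0 <= u <= 1 by move: u01; rewrite in_itv.
have {}u0 : 0 < u.
  rewrite lt_def u0 andbT; apply: contraTneq sf => u00.
  by rewrite -psi0 -[X in psi X]u00 psiu ltxx.
have zu : cell zs (gam u) by apply: cell_segment => //; rewrite ltW.
have [b br fu] := fr _ zu.
have cu : lin (c b) (hx (gam u)) = e * u.
  by apply/eqP; rewrite -subr_eq0 linZl linBl -fu -/(psi u) psiu.
have [cle|[c0 cge]] := sgnc b br.
  by have := cle _ zu; rewrite cu leNgt mulr_gt0.
have := eP _ (map_f (fun b => lin (c b) (hx x0)) br) c0.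
apply/negP; rewrite -leNgt -(ler_pM2r u0) -cu hx_segment linDr !linZr mulrC.
by rewrite lerDr mulr_ge0 ?subr_ge0 ?cge.
Qed.

End PiecewiseLinear.
Arguments cells R {n} zss.

(** * Rational polyhedra and integral piecewise affine maps *)

Section RationalPolyhedra.
Variable R : realType.

Lemma cells_splits n (Pr : seq 'rV[int]_(n + 1) -> Prop) zss :
  (forall zs, zs \in zss -> splits R Pr zs) ->
  exists2 zss', cells R zss' = cells R zss &
    forall zs, zs \in zss' -> positive zs /\ Pr zs.
Proof.
elim: zss => [|zs zss IH] H; first by exists [::].
have [|zss1 zss1E zss1P] := IH.
  by move=> z zin; apply: H; rewrite inE zin orbT.
have [zss2 [zss2E zss2P]] := H _ (mem_head _ _).
exists (zss2 ++ zss1) => [|z]; last by rewrite mem_cat => /orP[/zss2P|/zss1P].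
apply/seteqP; split=> x [z].
  rewrite mem_cat => /orP[zin zx|zin zx].
    by exists zs; rewrite ?mem_head //; apply/zss2E; exists z.
  have [z' z'in z'x] : cells R zss x by rewrite -zss1E; exists z.
  by exists z' => //; rewrite inE z'in orbT.
rewrite inE => /orP[/eqP -> /zss2E[z' zin zx]|zin zx].
  by exists z' => //; rewrite mem_cat zin.
have [z' z'in z'x] : cells R zss1 x by rewrite zss1E; exists z.
by exists z' => //; rewrite mem_cat z'in orbT.
Qed.

(** After cutting each cell by the differences of all pairs of pieces, the pieces are weakly ordered
    on every part; [f] is then affine there and the max-min formula applies to the refined cells. *)
Lemma continuous_piecewise_term n zss (f : 'rV[R]_n -> R) (r : seq 'cV[int]_(n + 1)) :
  (forall zs, zs \in zss -> positive zs) ->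
  {within cells R zss, continuous f} ->
  (forall x, cells R zss x -> exists2 a, a \in r & f x = lin a (hx x)) ->
  exists t, forall x, cells R zss x -> f x = teval x t.
Proof.
move=> pzss cf fr.
have [|zss' <- /cells_term //] := @cells_splits _ (affine_on f) zss.
move=> zs zin.
pose sgn (ab : 'cV[int]_(n + 1) * 'cV[int]_(n + 1)) := sign_definite R (ab.1 - ab.2).
have := @splits_all R n _ (allpairs pair r r) sgn zs
  (fun ab => @sign_definite_hereditary R n (ab.1 - ab.2))
  (fun ab => @splits_sign R n (ab.1 - ab.2)) (pzss _ zin).
move=> /splits_bind; apply=> zs' sub pzs' sgnP.
have sub' : cell zs' `<=` cells R zss by move=> x /sub; exists zs.
apply: splits_id => //; apply: (@continuous_piecewise_cell R n f zs' r) => //.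
- exact: continuous_subspaceW cf.
- by move=> x /sub'; exact: fr.
- by move=> a b ar br; apply: (sgnP (a, b)); apply/allpairsP; exists (a, b).
Qed.

(** Rescaling a generator by a positive factor does not change the cone, and the last coordinate 1
    of [hx x] forces the coefficients to sum to 1. *)
Lemma conv_cell n (S : {fset 'rV[rat]_n}) zs :
  (forall q, q \in S -> exists2 z, z \in zs &
     exists2 k : R, 0 < k & ivec R z = k *: hx (ratpt R q)) ->
  (forall z, z \in zs -> exists2 q, q \in S &
     exists2 k : R, 0 < k & ivec R z = k *: hx (ratpt R q)) ->
  Defs.conv R S = cell zs.
Proof.
move=> Szs zsS; apply/seteqP; split=> [x [c [c0 c1 xE]]|x zx].
  rewrite xE {x xE}.
  have hsum : hx (\sum_(q <- S) c q *: ratpt R q) =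
      \sum_(q <- S) c q *: hx (ratpt R q).
    rewrite /hx; under [RHS]eq_bigr do rewrite scale_row_mx.
    rewrite -[X in row_mx _ X]scale1r -[X in X *: 1]c1 scaler_suml.
    by elim/big_rec3: _ => [|q u v w _ <-]; rewrite ?row_mx0 ?add_row_mx.
  rewrite /cell /= hsum big_seq; elim/big_ind: _; [exact: cone0 | exact: coneD |].
  move=> q qS; have [z zin [k k0 zE]] := Szs q qS.
  apply: coneZ; first exact: c0.
  by apply: (coneZK k0); rewrite -zE; exact: cone_gen.
have : exists2 c : 'rV[rat]_n -> R, (forall q, q \in S -> 0 <= c q) &
    hx x = \sum_(q <- S) c q *: hx (ratpt R q).
  move: zx; rewrite /cell /=; move: (hx x) => y; move: y.
  apply: cone_min => [|y1 y2 [c1 c10 ->] [c2 c20 ->]|k y k0 [c c0 ->]|z /zsS] /=.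
  - by exists (fun=> 0) => //; rewrite big1 // => q _; rewrite scale0r.
  - exists (fun q => c1 q + c2 q) => [q qS|]; first by rewrite addr_ge0 ?c10 ?c20.
    by rewrite -big_split; apply: eq_bigr => q _; rewrite scalerDl.
  - exists (fun q => k * c q) => [q qS|]; first by rewrite mulr_ge0 ?c0.
    by rewrite scaler_sumr; apply: eq_bigr => q _; rewrite scalerA.
  - move=> [q qS [k k0 ->]]; exists (fun q' => if q' == q then k else 0).
      by move=> q' _; case: ifP => // _; exact: ltW.
    rewrite (big_rem q) //= eqxx big_seq big1 ?addr0 // => q'.
    by rewrite (mem_rem_uniq _ (fset_uniq S)) => /andP[/negPf -> _]; rewrite scale0r.
move=> [c c0 xE]; exists c; split=> //.
  rewrite -(lin_last_hx x) xE.
  elim/big_rec2: _ => [|q u v _ ->]; first by rewrite lin0r.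
  by rewrite linDr linZr lin_last_hx mulr1.
rewrite -[LHS](row_mxKl x (1 : 'M[R]_1)) -/(hx x) xE.
elim/big_rec2: _ => [|q u v _ <-]; first by rewrite linear0.
by rewrite linearD linearZ /= row_mxKl.
Qed.

Lemma ratpt_integral n (q : 'rV[rat]_n) : exists z : 'rV[int]_(n + 1),
  0 < ilin (last_coord n) z /\
  ivec R z = (ilin (last_coord n) z)%:~R *: hx (ratpt R q).
Proof.
(* The product of the denominators instead of the least common one: any positive multiple of
   [hx (ratpt R q)] generates the same ray. *)
pose D : int := \prod_j denq (q 0 j).
exists (row_mx (\row_i (numq (q 0 i) * \prod_(j | j != i) denq (q 0 j))) (const_mx D)).
split.
  rewrite /ilin mul_row_col mulmx0 add0r mulmx1 mxE.
  by apply: prodr_gt0 => j _; exact: denq_gt0.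
rewrite /ilin mul_row_col mulmx0 add0r mulmx1 mxE /ivec map_row_mx /hx scale_row_mx.
congr row_mx; apply/matrixP => i j; rewrite !mxE ?ord1 ?mulr1 //.
have DE : D = denq (q 0 j) * \prod_(k | k != j) denq (q 0 k) by rewrite /D (bigD1 j).
rewrite -[in RHS](divq_num_den (q 0 j)) fmorph_div /= !ratr_int DE !intrM.
rewrite [RHS]mulrAC; congr (_ * _); rewrite mulrCA.
by rewrite divff ?mulr1 // intr_eq0 denq_eq0.
Qed.

Lemma integral_ratpt n (z : 'rV[int]_(n + 1)) : 0 < ilin (last_coord n) z ->
  exists q : 'rV[rat]_n, ivec R z = (ilin (last_coord n) z)%:~R *: hx (ratpt R q).
Proof.
move=> z0; have z0' : lin (last_coord n) (ivec R z) != 0.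
  by rewrite lin_ivec intr_eq0 gt_eqF.
exists ((ilin (last_coord n) z)%:~R^-1 *: map_mx intr (lsubmx z)).
rewrite {1}(hx_normalize z0') lin_ivec; congr (_ *: hx _).
by apply/matrixP => i j; rewrite !mxE rmorphM fmorphV /= !ratr_int.
Qed.

Lemma rational_polyhedronP n (P : set 'rV[R]_n) : rational_polyhedron P <->
  exists2 zss, (forall zs, zs \in zss -> positive zs) & P = cells R zss.
Proof.
split=> [[s ->]|[zss pzss ->]].
  have /choice[h hP] := @ratpt_integral n.
  have hpos q : 0 < (ilin (last_coord n) (h q))%:~R :> R.
    by rewrite ltr0z; have [] := hP q.
  have SE (S : {fset 'rV[rat]_n}) : Defs.conv R S = cell (map h S).
    apply: conv_cell => [q qS|z /mapP[q qS ->]].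
      exists (h q); first exact: map_f.
      by exists (ilin (last_coord n) (h q))%:~R => //; have [] := hP q.
    exists q => //.
    by exists (ilin (last_coord n) (h q))%:~R => //; have [] := hP q.
  have hsP zs := @mapP {fset 'rV[rat]_n} _ (fun T => map h T) s zs.
  exists [seq map h (enum_fset T) | T <- s].
    by move=> zs /hsP [T _ ->] z /mapP [q _ ->]; have [] := hP q.
  apply/seteqP; split=> [x [T /= Ts Tx]|x [zs /hsP [T Ts ->] Tx]].
    by exists (map h T); [apply/hsP; exists T | rewrite -SE].
  by exists T => //; rewrite SE.
have /choice[h hP] : forall z : 'rV[int]_(n + 1), exists q : 'rV[rat]_n,
    0 < ilin (last_coord n) z ->
    ivec R z = (ilin (last_coord n) z)%:~R *: hx (ratpt R q).
  move=> z; have [z0|_] := ltP 0 (ilin (last_coord n) z); last by exists 0.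
  by have [q qP] := integral_ratpt z0; exists q.
have SE zs : zs \in zss -> Defs.conv R [fset h z | z in zs]%fset = cell zs.
  move=> zin; have kP z : z \in zs -> exists2 k : R, 0 < k &
      ivec R z = k *: hx (ratpt R (h z)).
    move=> /(pzss _ zin) z0; exists (ilin (last_coord n) z)%:~R; rewrite ?ltr0z //.
    exact: hP.
  apply: conv_cell => [q /imfsetP[z /= zzs ->]|z zzs]; first by exists z; last exact: kP.
  by exists (h z); [apply/imfsetP; exists z | exact: kP].
exists [seq [fset h z | z in zs]%fset | zs : seq _ <- zss].
apply/seteqP; split=> [x [zs zin zx]|x [S /= /mapP[zs zin ->]]].
  exists [fset h z | z in zs]%fset; last by rewrite SE.
  by apply/mapP; exists zs.
by rewrite SE // => zx; exists zs.
Qed.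

Lemma cone_image d d' (M : 'M[int]_(d, d')) zs y' :
  cone [seq z *m M | z <- zs] y' <->
  exists2 y : 'rV[R]_d, cone zs y & y' = y *m map_mx intr M.
Proof.
elim: zs y' => [|z zs IH] y' /=.
  by split=> [->|[y -> ->]]; [exists 0; rewrite ?mul0mx | rewrite mul0mx].
split=> [[u u0 /IH[y zy y'E]]|[y [u u0 zy] ->]].
  exists (y + u *: ivec R z); first by exists u; rewrite ?addrK.
  by rewrite mulmxDl -scalemxAl -y'E /ivec map_mxM subrK.
exists u => //; apply/IH; exists (y - u *: ivec R z) => //.
by rewrite mulmxBl -scalemxAl /ivec map_mxM.
Qed.

Definition term_map n m (u : 'I_m -> lterm n) (x : 'rV[R]_n) : 'rV[R]_m :=
  \row_k teval x (u k).

Lemma term_map_continuous n m (u : 'I_m -> lterm n) : continuous (term_map u).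
Proof.
move=> x; apply: (@rV_cvg R _ (nbhs x) _ m) => i; rewrite mxE.
under eq_fun do rewrite mxE.
exact: teval_continuous.
Qed.

Lemma image_cell n m (u : 'I_m -> lterm n) zs : positive zs ->
  (forall k, affine_on (fun x : 'rV[R]_n => teval x (u k)) zs) ->
  exists2 zs', positive zs' & cell zs' = term_map u @` cell zs.
Proof.
move=> pzs /choice[a aP].
(* The last column copies the homogenizing coordinate, so [M] induces [term_map u] on the cell and
   keeps the generators positive. *)
pose M : 'M[int]_(n + 1, m + 1) := row_mx (\matrix_(i, k) a k i 0) (last_coord n).
have Ml : M *m last_coord m = last_coord n.
  by rewrite mul_row_col mulmx0 add0r mulmx1.
have linM (y : 'rV[R]_(n + 1)) :
    lin (last_coord m) (y *m map_mx intr M) = lin (last_coord n) y.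
  by rewrite /lin -mulmxA -map_mxM Ml.
have hxM x : cell zs x -> hx x *m map_mx intr M = hx (term_map u x).
  move=> zx; rewrite [in RHS]/hx map_row_mx mul_mx_row; congr row_mx; last first.
    by apply/matrixP => i j; rewrite !ord1 [RHS]mxE; exact: (lin_last_hx x).
  apply/rowP => k; rewrite !mxE aP // /lin mxE.
  by apply: eq_bigr => i _; rewrite !mxE.
exists [seq z *m M | z <- zs].
  by move=> _ /mapP[z zin ->]; rewrite /ilin -mulmxA Ml; exact: pzs.
apply/seteqP; split=> [x' /cone_image[y zy x'y]|_ [x zx <-]]; last first.
  by apply/cone_image; exists (hx x) => //; rewrite hxM.
have y1 : lin (last_coord n) y = 1 by rewrite -linM -x'y lin_last_hx.
have [|x zx yx] := cell_cone zy; first by rewrite y1.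
exists x => //; move: x'y; rewrite yx y1 scale1r hxM //.
by move=> /eq_row_mx[].
Qed.

Lemma term_map_cells n m (u : 'I_m -> lterm n) (P : set 'rV[R]_n) :
  rational_polyhedron P -> exists2 zss, P = cells R zss &
    forall zs, zs \in zss -> positive zs /\
      forall k, affine_on (fun x : 'rV[R]_n => teval x (u k)) zs.
Proof.
move=> /rational_polyhedronP[zss pzss ->].
have [|zss' <- zssP] := @cells_splits _
    (fun zs => forall k, k \in enum 'I_m ->
       affine_on (fun x : 'rV[R]_n => teval x (u k)) zs) zss.
  move=> zs /pzss; apply: splits_all => [i|i zs']; first exact: affine_on_hereditary.
  exact: splits_term.
exists zss' => // zs /zssP[pzs aff]; split=> // k.
by apply: aff; rewrite mem_enum.
Qed.

Lemma rational_polyhedron_image n m (u : 'I_m -> lterm n) (P : set 'rV[R]_n) :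
  rational_polyhedron P -> rational_polyhedron (term_map u @` P).
Proof.
move=> /(@term_map_cells _ _ u)[zss' -> zssP].
have /choice[h hP] : forall zs, exists zs', zs \in zss' ->
    positive zs' /\ cell zs' = term_map u @` cell zs.
  move=> zs; have [zin|_] := boolP (zs \in zss'); last by exists [::].
  have [pzs aff] := zssP _ zin.
  by have [zs' ? ?] := image_cell pzs aff; exists zs'.
apply/rational_polyhedronP; exists (map h zss').
  by move=> _ /mapP[zs zin ->]; have [] := hP _ zin.
apply/seteqP; split=> [_ [x [zs zin zx] <-]|x' [_ /mapP[zs zin ->]]].
  exists (h zs); first exact: map_f.
  by have [_ ->] := hP _ zin; exists x.
by have [_ ->] := hP _ zin; move=> [x zx <-]; exists x => //; exists zs.
Qed.

Lemma rational_polyhedron_zeroset n (P : set 'rV[R]_n) : rational_polyhedron P ->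
  exists t, forall x, teval x t = 0 <-> P x.
Proof.
move=> /rational_polyhedronP[zss _ ->].
by have [t tP] := rational_cells_term R zss; exists t => x; have [] := tP x.
Qed.

(** Coordinatewise: the columns of the finitely many integral matrices are the pieces of a
    coordinate of [f]. *)
Lemma Zmap_term n m (P : set 'rV[R]_n) (f : 'rV[R]_n -> 'rV[R]_m) :
  rational_polyhedron P -> Zmap P f ->
  exists u, forall x, P x -> f x = term_map u x.
Proof.
move=> /rational_polyhedronP[zss pzss ->] [cf [s sP]].
have /choice[u uP] : forall k, exists t, forall x, cells R zss x ->
    f x 0 k = teval x t.
  move=> k; apply: (@continuous_piecewise_term _ _ (fun x => f x 0 k)
      [seq col_mx (col k p.1) (col k p.2) | p <- s]) => //.
    apply/subspace_continuousP => x zx; have /subspace_continuousP/(_ x zx) fx := cf.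
    by move=> B Bx; exact: (fx _ (@coord_continuous R _ _ 0 k (f x) B Bx)).
  move=> x /sP[p ps ->]; exists (col_mx (col k p.1) (col k p.2)).
    by apply/mapP; exists p.
  rewrite lin_hx /affineZ !mxE; congr (_ + _).
  by apply: eq_bigr => i _; rewrite !mxE.
by exists u => x zx; apply/rowP => k; rewrite mxE; exact: uP.
Qed.

Lemma term_map_Zmap n m (u : 'I_m -> lterm n) (P : set 'rV[R]_n) :
  rational_polyhedron P -> Zmap P (term_map u).
Proof.
move=> /(@term_map_cells _ _ u)[zss -> zssP]; split.
  exact/continuous_subspaceT/term_map_continuous.
have /choice[a aP] : forall zs, exists a : 'I_m -> 'cV[int]_(n + 1), zs \in zss ->
    forall k (x : 'rV[R]_n), cell zs x -> teval x (u k) = lin (a k) (hx x).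
  move=> zs; have [zin|_] := boolP (zs \in zss); last by exists (fun=> 0).
  by have [_ /choice[a aP]] := zssP _ zin; exists a.
exists [seq (\matrix_(i, k) usubmx (a zs k) i 0, \row_k dsubmx (a zs k) 0 0) | zs <- zss].
move=> x [zs zin zx].
exists (\matrix_(i, k) usubmx (a zs k) i 0, \row_k dsubmx (a zs k) 0 0).
  by apply/mapP; exists zs.
apply/rowP => k; rewrite mxE (aP _ zin _ _ zx) -[in LHS](vsubmxK (a zs k)) lin_hx.
rewrite /affineZ !mxE; congr (_ + _).
by apply: eq_bigr => i _; rewrite !mxE.
Qed.

Lemma mcfun_term n (P : set 'rV[R]_n) (f : mcfun R n) :
  rational_polyhedron P -> P `<=` cube R n ->
  exists t, forall x : cube R n, P (\val x) -> f x = teval (\val x) t.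
Proof.
move=> /rational_polyhedronP[zss pzss ->] sub; have [cf [s sP]] := mcfunP f.
(* [f] lives on the subtype of points of the cube; its extension by 0 is total, and the values
   outside the cube are immaterial since [P] lies inside. *)
pose g := 'valL_(0 : R) f.
have gE (x : cube R n) : g (\val x) = f x.
  exact: (congr1 (fun h => h x) (valLK 0 (mcval f))).
have [||t tP] := @continuous_piecewise_term n zss g [seq col_mx p.1 p.2 | p <- s] pzss.
- by apply: continuous_subspaceW sub _; exact/subspace_valL_continuousP'.
- move=> x /sub xC; have [p ps fx] := sP (exist _ x (mem_set xC)).
  exists (col_mx p.1 p.2); first by apply/mapP; exists p.
  by rewrite lin_hx -[RHS]fx -gE.
- by exists t => x /tP <-; rewrite gE.
Qed.

End RationalPolyhedra.

(** * Orbits and their unital lattice-groups *)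

Section TermEvaluation.

Fixpoint geval (G : ulgroupType) n (e : 'I_n -> G) (t : lterm n) : G :=
  match t with
  | LVar i => e i
  | LOne => order_unit
  | LAdd t1 t2 => geval e t1 + geval e t2
  | LOpp t1 => - geval e t1
  | LJoin t1 t2 => ljoin (geval e t1) (geval e t2)
  | LMeet t1 t2 => lmeet (geval e t1) (geval e t2)
  end.

Fixpoint tsubst n m (u : 'I_m -> lterm n) (t : lterm m) : lterm n :=
  match t with
  | LVar i => u i
  | LOne => LOne
  | LAdd t1 t2 => LAdd (tsubst u t1) (tsubst u t2)
  | LOpp t1 => LOpp (tsubst u t1)
  | LJoin t1 t2 => LJoin (tsubst u t1) (tsubst u t2)
  | LMeet t1 t2 => LMeet (tsubst u t1) (tsubst u t2)
  end.

Lemma geval_tsubst (G : ulgroupType) n m (e : 'I_n -> G) (u : 'I_m -> lterm n) t :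
  geval e (tsubst u t) = geval (fun k => geval e (u k)) t.
Proof. by elim: t => //= [t1 -> t2 ->|t ->|t1 -> t2 ->|t1 -> t2 ->]. Qed.

Lemma teval_tsubst (R : realType) n m (u : 'I_m -> lterm n) (x : 'rV[R]_n) t :
  teval x (tsubst u t) = teval (term_map u x) t.
Proof.
by elim: t => //= [i|t1 -> t2 ->|t ->|t1 -> t2 ->|t1 -> t2 ->]; rewrite ?mxE.
Qed.

Lemma ulhomN (G H : ulgroupType) (f : G -> H) : ulhom f -> {morph f : x / - x}.
Proof.
move=> fP x; have f0 : f 0 = 0.
  by apply: (@addrI _ (f 0)); rewrite -(ulhomD fP) !addr0.
by apply: (@addrI _ (f x)); rewrite -(ulhomD fP) !subrr.
Qed.

Lemma ulhom_geval (G H : ulgroupType) (f : G -> H) n (e : 'I_n -> G) t :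
  ulhom f -> f (geval e t) = geval (fun k => f (e k)) t.
Proof.
move=> fP; elim: t => //= [|t1 <- t2 <-|t <-|t1 <- t2 <-|t1 <- t2 <-].
- exact: ulhom_unit.
- exact: ulhomD.
- exact: ulhomN.
- exact: ulhom_join.
- exact: ulhom_meet.
Qed.

Lemma ulhom_inverse (G H : ulgroupType) (f : G -> H) (g : H -> G) :
  cancel f g -> cancel g f -> ulhom f -> ulhom g.
Proof.
move=> fK gK fP; split=> [x y|x y|x y|]; apply: (can_inj fK); rewrite gK.
- by rewrite (ulhomD fP) !gK.
- by rewrite (ulhom_join fP) !gK.
- by rewrite (ulhom_meet fP) !gK.
- by rewrite (ulhom_unit fP).
Qed.

Lemma ulhom_lpi (G : ulgroupType) (S : lideal G) : ulhom (lpi S : G -> lquot S).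
Proof.
by split=> [x y|x y|x y|]; [exact: lpiD | exact: lpi_join | exact: lpi_meet |].
Qed.

End TermEvaluation.

Section CoordinateFunctions.
Variables (R : realType) (n : nat).

Lemma mcnaughton_coord (k : 'I_n) :
  mcnaughton (fun x : cube R n => (\val x : 'rV[R]_n) 0 k).
Proof.
split.
  have := @continuous_subspaceT _ _ (cube R n) _ (@coord_continuous R 1 n 0 k).
  by move=> /subspace_sigL_continuousP.
exists [:: (delta_mx k 0, 0)] => x; exists (delta_mx k 0, 0); rewrite ?mem_head //=.
by rewrite -lin_hx lin_var.
Qed.

Definition mccoord k : mcfun R n := McFun (asboolT (mcnaughton_coord k)).

Lemma mcvalB (f g : mcfun R n) x : (f - g) x = f x - g x.
Proof. by []. Qed.

Lemma geval_mccoord (t : lterm n) (x : cube R n) :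
  (geval mccoord t : mcfun R n) x = teval (\val x) t.
Proof.
by elim: t => //= [t1 <- t2 <-|t <-|t1 <- t2 <-|t1 <- t2 <-].
Qed.

End CoordinateFunctions.

Section OrbitGroup.
Variables (R : realType) (K : choiceType) (n : nat).
Variables (W : nat -> wcomplex K) (w : n.-tuple K).
Hypothesis W_stellar : stellar W.

Lemma finite_fsubsets (T : choiceType) (A : {fset T}) :
  finite_set [set B | (B `<=` A)%fset].
Proof.
apply: (@sub_finite_set _ _ [set` fpowerset A]); last exact: finite_fset.
by move=> B BA /=; rewrite fpowersetE.
Qed.

(** Complexes are encoded as sets, so finiteness is carried along the sequence: a deletion removes a
    simplex, and a blow-up only adds joins of the new vertex with faces of existing simplexes. *)
Lemma realization_finite j : finite_set (realization R W w j).1.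
Proof.
elim: j => [|j] /=.
  apply: finite_image; apply: sub_finite_set (finite_fsubsets (vertices (W 0%N))).
  by move=> F; have [W0 _] := W_stellar 0%N; exact: wcomplex_faces.
case: (realization R W w j) => D i /= Dfin.
case: (move_of _ _) => [|M|a b c] //=; first exact: finite_setD.
set e := Farey_mediant _ _ _; rewrite finite_setU; split.
  by apply: sub_finite_set Dfin => T [].
apply: (@sub_finite_set _ _ (\bigcup_(T in D)
    [set (e |` F)%fset | F in [set F | (F `<=` T)%fset]])).
  by move=> S [T [F [DT _ FT _ ->]]]; exists T => //; exists F.
by apply: bigcup_finite => // T _; apply: finite_image; exact: finite_fsubsets.
Qed.

Lemma stellar_orbit_polyhedron j : rational_polyhedron (stellar_orbit R W w j).
Proof.
have /finite_seqP[s sE] := realization_finite j.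
by exists s; rewrite /stellar_orbit /cx_support sE.
Qed.

Definition orbit_coord k : orbit_group R W w := lpi _ (mccoord R k).

Lemma geval_orbit_coord t :
  geval orbit_coord t = lpi (orbit_ideal R W w) (geval (@mccoord R n) t).
Proof. by rewrite (ulhom_geval _ _ (ulhom_lpi _)). Qed.

(** Two classes are equal when their difference is in the ideal, that is, vanishes at some stage.
    This turns identities in the quotient into identities of functions far along the orbit. *)
Lemma eq_geval_orbit t t' : geval orbit_coord t = geval orbit_coord t' <->
  exists j, forall x, stellar_orbit R W w j x -> teval x t = teval x t'.
Proof.
rewrite !geval_orbit_coord lpiP orbit_idealP; split=> -[j jP]; exists j => x xP.
  have xC := orbit_cube xP; apply/eqP; rewrite -subr_eq0.
  have := jP (exist _ x (mem_set xC)) xP.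
  by rewrite mcvalB !geval_mccoord => /eqP.
by rewrite mcvalB !geval_mccoord (jP _ xP) subrr.
Qed.

Lemma orbit_group_term (a : orbit_group R W w) : exists t, a = geval orbit_coord t.
Proof.
have [t tP] := mcfun_term (repr a) (stellar_orbit_polyhedron 0)
  (@orbit_cube R K n W w 0%N).
exists t; rewrite geval_orbit_coord -[LHS]lpiK; apply/lpiP/orbit_idealP.
exists 0%N => x /tP xt.
by rewrite mcvalB geval_mccoord xt subrr.
Qed.

End OrbitGroup.

(** * Homomorphisms as substitutions and as maps between orbits *)

Section OrbitMorphisms.
Variables (R : realType) (K L : choiceType).
Variables (W : nat -> wcomplex K) (V : nat -> wcomplex L) (n m : nat).
Variables (w : n.-tuple K) (v : m.-tuple L).
Hypotheses (W_stellar : stellar W) (V_stellar : stellar V).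

Local Notation P := (stellar_orbit R W w).
Local Notation Q := (stellar_orbit R V v).
Local Notation GW := (orbit_group R W w).
Local Notation GV := (orbit_group R V v).
Local Notation xiW := (@orbit_coord R K n W w).
Local Notation xiV := (@orbit_coord R L m V v).

(** Duality reverses arrows: [psi] from [GV] to [GW] is substitution of the terms [u], hence
    geometrically the map [term_map u] from the space of [W] to that of [V]. *)
Lemma orbit_hom_geval (psi : GV -> GW) (u : 'I_m -> lterm n) t : ulhom psi ->
  (forall k, psi (xiV k) = geval xiW (u k)) ->
  psi (geval xiV t) = geval xiW (tsubst u t).
Proof.
move=> psiP psiu; rewrite (ulhom_geval _ _ psiP) geval_tsubst.
by congr (geval _ t); apply/funext.
Qed.

(** A term with zero set [Q k] represents 0 in [GV], so its image under [psi], the same term with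
    [u] substituted, vanishes on some [P j]. *)
Lemma orbit_hom_absorb (psi : GV -> GW) (u : 'I_m -> lterm n) k : ulhom psi ->
  (forall k, psi (xiV k) = geval xiW (u k)) ->
  exists j, forall x, P j x -> Q k (term_map u x).
Proof.
move=> psiP psiu.
have [t tP] := rational_polyhedron_zeroset (stellar_orbit_polyhedron R v V_stellar k).
(* [z] stands for 0, which has no symbol of its own among the terms. *)
pose z : lterm m := LAdd LOne (LOpp LOne).
have z0 y : teval y z = 0 :> R by rewrite /= subrr.
have : geval xiV t = geval xiV z.
  by apply/eq_geval_orbit; exists k => y /tP ->; rewrite z0.
move=> /(congr1 psi); rewrite !(orbit_hom_geval _ psiP psiu).
move=> /eq_geval_orbit[j jP]; exists j => x /jP.
by rewrite !teval_tsubst z0 => /tP.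
Qed.

(** Read as an identity of functions, [psi (phi (xiW l)) = xiW l] holds on some stage for each [l];
    as orbits decrease, the largest of these finitely many stages serves all coordinates. *)
Lemma orbit_hom_section (psi : GV -> GW) (phi : GW -> GV)
    (u : 'I_m -> lterm n) (g : 'I_n -> lterm m) : ulhom psi -> cancel phi psi ->
  (forall k, psi (xiV k) = geval xiW (u k)) ->
  (forall l, phi (xiW l) = geval xiV (g l)) ->
  exists j, forall x, P j x -> term_map g (term_map u x) = x.
Proof.
move=> psiP phiK psiu phig.
have [j jP] : exists j, forall l, l \in enum 'I_n ->
    forall x, P j x -> teval (term_map u x) (g l) = x 0 l.
  apply: uniform_bound => [l i j _ ij H x xP|l _]; first exact/H/(orbit_le ij).
  have : geval xiW (tsubst u (g l)) = geval xiW (LVar l).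
    by rewrite -(orbit_hom_geval _ psiP psiu) -phig phiK.
  by move=> /eq_geval_orbit[j jP]; exists j => x /jP; rewrite teval_tsubst.
by exists j => x xP; apply/rowP => l; rewrite mxE jP // mem_enum.
Qed.

End OrbitMorphisms.

(** * The two implications *)

Section Theorem6p1.
Variables (R : realType) (K L : choiceType).
Variables (W : nat -> wcomplex K) (V : nat -> wcomplex L) (n m : nat).
Variables (w : n.-tuple K) (v : m.-tuple L).
Hypotheses (W_stellar : stellar W) (V_stellar : stellar V).

Local Notation P := (stellar_orbit R W w).
Local Notation Q := (stellar_orbit R V v).
Local Notation GW := (orbit_group R W w).
Local Notation GV := (orbit_group R V v).
Local Notation xiW := (@orbit_coord R K n W w).
Local Notation xiV := (@orbit_coord R L m V v).

Lemma Zhomeo_of_isomorphism : ul_isomorphic GW GV ->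
  exists (i : nat) (eta : 'rV[R]_n -> 'rV[R]_m) (S : set 'rV[R]_m),
    [/\ rational_polyhedron S, Zhomeo (P i) S eta &
        confluent [set eta @` P j | j in [set j | (i <= j)%N]] (orbit_family R V v)].
Proof.
move=> [phi [phiP [psi phiK psiK]]].
have psiP := ulhom_inverse phiK psiK phiP.
have /choice[u psiu] : forall k, exists t, psi (xiV k) = geval xiW t.
  by move=> k; exact: orbit_group_term.
have /choice[g phig] : forall l, exists t, phi (xiW l) = geval xiV t.
  by move=> l; exact: orbit_group_term.
(* On [P i] the map [term_map g] is a left inverse of [term_map u], which is therefore the required
   homeomorphism; [k] below plays the same part for the opposite composite. *)
have [i iP] := orbit_hom_section psiP phiK psiu phig.
have [k kQ] := orbit_hom_section phiP psiK phig psiu.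
have polP := stellar_orbit_polyhedron R w W_stellar.
have polS := rational_polyhedron_image u (polP i).
exists i, (term_map u), (term_map u @` P i); split=> //.
  split; first exact: term_map_Zmap.
    split=> [x xP|x y|//]; first by exists x.
    by move=> /set_mem/iP xE /set_mem/iP yE uxy; rewrite -xE uxy yE.
  by exists (term_map g); split=> //; exact: term_map_Zmap.
split=> [_ [k' _ <-]|_ [j /= ij <-]].
  have [j jP] := orbit_hom_absorb V_stellar k' psiP psiu.
  exists (term_map u @` P (maxn i j)).
    by exists (maxn i j) => //=; rewrite leq_maxl.
  by move=> _ [x xP <-]; apply/jP/(orbit_le (leq_maxr i j)).
(* A point [y] far enough along the orbit of [V] is the image of [term_map g y], which lies in
   [P j]. *)
have [k' k'P] := orbit_hom_absorb W_stellar j phiP phig.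
exists (Q (maxn k k')); first by exists (maxn k k').
move=> y yQ; exists (term_map g y); first exact/k'P/(orbit_le (leq_maxr k k')).
exact/kQ/(orbit_le (leq_maxl k k')).
Qed.

Lemma isomorphism_of_Zhomeo i (eta : 'rV[R]_n -> 'rV[R]_m) (S : set 'rV[R]_m) :
  rational_polyhedron S -> Zhomeo (P i) S eta ->
  confluent [set eta @` P j | j in [set j | (i <= j)%N]] (orbit_family R V v) ->
  ul_isomorphic GW GV.
Proof.
move=> polS [etaZ [etaS _ _] [gam [gamZ gamK]]] [etaQ Qeta].
have [u uP] := Zmap_term (stellar_orbit_polyhedron R w W_stellar i) etaZ.
have [g gP] := Zmap_term polS gamZ.
have gK x : P i x -> term_map g (eta x) = x.
  by move=> xP; rewrite -gP ?gamK //; exact: etaS.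
(* From left to right, substitution of [g] is well defined on classes; from right to left, it is
   injective. Each direction uses one half of confluence. *)
have wd t t' : geval xiW t = geval xiW t' <->
    geval xiV (tsubst g t) = geval xiV (tsubst g t').
  split=> /eq_geval_orbit[j jP]; apply/eq_geval_orbit.
    have [|_ [k _ <-] kS] := Qeta (eta @` P (maxn i j)).
      by exists (maxn i j) => //=; rewrite leq_maxl.
    exists k => _ /kS[x xP <-]; rewrite !teval_tsubst gK.
      exact/jP/(orbit_le (leq_maxr i j)).
    exact: (orbit_le (leq_maxl i j)) xP.
  have [|_ [k /= ik <-] kS] := etaQ (Q j); first by exists j.
  exists k => x xP; have := jP (eta x); rewrite !teval_tsubst gK.
    by apply; apply: kS; exists x.
  exact: orbit_le xP.
have /choice[T TP] : forall a : GW, exists t, a = geval xiW t.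
  by move=> a; exact: orbit_group_term.
pose phi a := geval xiV (tsubst g (T a)).
have phiE t : phi (geval xiW t) = geval xiV (tsubst g t) by apply/wd; rewrite -TP.
have phi_inj : injective phi.
  by move=> a b; rewrite [a]TP [b]TP !phiE => /wd.
have phi_surj b : exists a, phi a = b.
  have [t ->] := orbit_group_term V_stellar b.
  exists (geval xiW (tsubst u t)); rewrite phiE; apply/eq_geval_orbit.
  have [|_ [k _ <-] kS] := Qeta (eta @` P i); first by exists i => /=.
  exists k => _ /kS[x xP <-].
  by rewrite !teval_tsubst gK // uP.
exists phi; split; last first.
  have [psi psiP] := choice phi_surj.
  by exists psi => // a; apply: phi_inj; rewrite psiP.
(* Each operation on classes of terms is by conversion the class of a compound term, and
   substitution commutes with the term constructors. *)
split=> [a b|a b|a b|].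
- by rewrite [a]TP [b]TP !phiE -[_ + _]/(geval xiW (LAdd _ _)) phiE.
- by rewrite [a]TP [b]TP !phiE -[ljoin _ _]/(geval xiW (LJoin _ _)) phiE.
- by rewrite [a]TP [b]TP !phiE -[lmeet _ _]/(geval xiW (LMeet _ _)) phiE.
- by rewrite -[order_unit]/(geval xiW LOne) phiE.
Qed.

End Theorem6p1.

Theorem theorem6p1 (R : realType) (K L : choiceType)
    (W : nat -> wcomplex K) (V : nat -> wcomplex L) (n m : nat)
    (w : n.-tuple K) (v : m.-tuple L)
    (W_stellar : stellar W) (V_stellar : stellar V)
    (w_enum : enumerates w (W 0%N)) (v_enum : enumerates v (V 0%N)) :
  ul_isomorphic (orbit_group R W w) (orbit_group R V v) <->
  exists (i : nat) (eta : 'rV[R]_n -> 'rV[R]_m) (Q : set 'rV[R]_m),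
    [/\ rational_polyhedron Q,
        Zhomeo (stellar_orbit R W w i) Q eta &
        confluent [set eta @` stellar_orbit R W w j | j in [set j | (i <= j)%N]]
                  (orbit_family R V v)].
Proof.
split; first exact: Zhomeo_of_isomorphism.
by move=> [i [eta [S [polS etaZ conf]]]]; exact: isomorphism_of_Zhomeo etaZ conf.
Qed.
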